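(* Suppose the standing assumptions (A-a), (A-b), (A-c) of the context hold, and run NESTT-G with, for $i=1,\dots,N$, $$\alpha_i=p_i=\frac{\sqrt{L_i/N}}{\sum_{j=1}^{N}\sqrt{L_j/N}},\qquad \eta_i=3\Big(\sum_{j=1}^{N}\sqrt{L_j/N}\Big)\sqrt{L_i/N},\qquad \beta=\frac{1}{3\big(\sum_{j=1}^{N}\sqrt{L_j/N}\big)^2}.$$ Then, almost surely, every limit point of the sequence $(x^r,z^r,\lambda^r)$ generated by NESTT-G is a stationary solution of the problem $\min_{x,z}\ \frac1N\sum_{i=1}^N g_i(x_i)+g_0(z)+h(z)$ s.t. $x_i=z$, $i=1,\dots,N$. Further, for every $R\ge 1$, with $m$ drawn uniformly at random from $\{1,\dots,R\}$ (independently of the algorithm): 1) $\displaystyle \mathbb{E}[G^m]\le \frac{80}{3}\Big(\sum_{i=1}^N\sqrt{L_i/N}\Big)^2\,\frac{\mathbb{E}[Q^1-Q^{R+1}]}{R}$; 2) $\displaystyle \mathbb{E}[G^m]+\mathbb{E}\Big[\sum_{i=1}^N 3\eta_i^2\,\|x_i^{m+1}-z^{m}\|^2\Big]\le \frac{80}{3}\Big(\sum_{i=1}^N\sqrt{L_i/N}\Big)^2\,\frac{\mathbb{E}[Q^1-Q^{R+1}]}{R}$.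
   Context: Problem. $Z\subseteq\mathbb{R}^d$; $g_0,g_1,\dots,g_N:\mathbb{R}^d\to\mathbb{R}$ are smooth, possibly nonconvex; $p:\mathbb{R}^d\to\mathbb{R}$ is convex and lower semicontinuous, possibly nonsmooth. Put $g:=\frac1N\sum_{i=1}^N g_i$, $f:=g+g_0+p$, $h:=\iota_Z+p$ ($\iota_Z$ is the indicator function of $Z$: $0$ on $Z$, $+\infty$ off $Z$). The original problem is $\min_{z\in Z} f(z)$. For $x=(x_1,\dots,x_N)$, $\lambda=(\lambda_1,\dots,\lambda_N)$ and penalty parameters $\eta_i>0$, the augmented Lagrangian is $$L(x,z;\lambda)=\sum_{i=1}^N\Big(\tfrac1N g_i(x_i)+\langle\lambda_i,x_i-z\rangle+\tfrac{\eta_i}{2}\|x_i-z\|^2\Big)+g_0(z)+h(z).$$ Standing assumptions. (A-a) $Z$ is closed and convex, and $\underline f:=\min_{z\in Z}f(z)>-\infty$. (A-b) $\|\nabla g_i(y)-\nabla g_i(z)\|\le L_i\|y-z\|$ for $i=0,\dots,N$, $\|\nabla g(y)-\nabla g(z)\|\le L\|y-z\|$ for all $y,z$, and $L_0\le\frac1N\sum_{i=1}^N L_i$. (A-c) $\eta_i>L_i/N$ for $i=1,\dots,N$; and if $g_0$ is nonconvex, $\sum_{i=1}^N\eta_i>3L_0$. NESTT-G. Given constants $\alpha_i>0$ and sampling probabilities $p_i>0$, $\sum_i p_i=1$, let $V_i(x_i,z;\lambda_i)=\frac1N g_i(z)+\frac1N\langle\nabla g_i(z),x_i-z\rangle+\langle\lambda_i,x_i-z\rangle+\frac{\alpha_i\eta_i}{2}\|x_i-z\|^2$.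 Start from $z^1\in Z$, points $y_i^0\in\mathbb{R}^d$ and $\lambda_i^1=-\frac1N\nabla g_i(y_i^0)$. For $r=1,2,\dots$: draw $i_r\in\{1,\dots,N\}$ independently of the past with $\Pr(i_r=i)=p_i$; set $x^{r+1}_{i_r}=\arg\min_{x_{i_r}}V_{i_r}(x_{i_r},z^r;\lambda^r_{i_r})$ and $\lambda^{r+1}_{i_r}=\lambda^r_{i_r}+\alpha_{i_r}\eta_{i_r}(x^{r+1}_{i_r}-z^r)$; for $j\ne i_r$ set $\lambda_j^{r+1}=\lambda_j^r$, $x_j^{r+1}=z^r$; then $z^{r+1}=\arg\min_{z\in Z}L(x^{r+1},z;\lambda^r)$. Memory points: for $r\ge1$, $y^r_{i_r}=z^r$, and $y^r_j=y^{r-1}_j$ for $j\neq i_r$ (so $y_j^r$ is the value of $z$ at the last iteration $\le r$ in which $j$ was picked). Potential function: $$Q^r:=\sum_{i=1}^N\tfrac1N g_i(z^r)+\sum_{i=1}^N\frac{3p_i\eta_i}{(\alpha_i\eta_i)^2}\Big\|\tfrac1N\big(\nabla g_i(y_i^{r-1})-\nabla g_i(z^r)\big)\Big\|^2+g_0(z^r)+h(z^r).$$ Optimality gap: for $\gamma>0$, $\mathrm{prox}_h^{\gamma}[v]:=\arg\min_{u\in Z}\ p(u)+\frac{\gamma}{2}\|v-u\|^2$ and $\tilde\nabla f_\gamma(z):=\gamma\big(z-\mathrm{prox}^\gamma_h[z-\frac1\gamma\nabla(g(z)+g_0(z))]\big)$. Set $G^r:=\|\tilde\nabla f_{1/\beta}(z^r)\|^2=\frac1{\beta^2}\|z^r-\mathrm{prox}_h^{1/\beta}[z^r-\beta\nabla(g(z^r)+g_0(z^r))]\|^2$,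 where $\beta=1/\sum_i\eta_i$. Stationary solution of the constrained problem: a triple $(x,z,\lambda)$ with $x_i=z$ and $\frac1N\nabla g_i(x_i)+\lambda_i=0$ for all $i=1,\dots,N$, and $0\in\nabla g_0(z)-\sum_{i=1}^N\lambda_i+\partial h(z)$. *)

(* Defs.v *)
From HB Require Import structures.
From mathcomp Require Import all_boot all_order all_algebra.
From mathcomp Require Import all_classical all_reals all_analysis.

Set Implicit Arguments.
Unset Strict Implicit.
Unset Printing Implicit Defensive.

Import Order.TTheory GRing.Theory Num.Theory numFieldNormedType.Exports.

Local Open Scope classical_set_scope.
Local Open Scope ring_scope.

Section euclidean.
Context {R : realType} {d : nat}.
Implicit Types (u v : 'rV[R]_d) (f : 'rV[R]_d -> R).

Definition dot u v : R := \sum_(j < d) u 0 j * v 0 j.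

(* The library norm on ['rV[R]_d] is the sup norm, hence this one. *)
Definition enorm u : R := Num.sqrt (dot u u).

Definition grad f u : 'rV[R]_d := \row_(j < d) 'D_(delta_mx 0 j) f u.

Definition lipschitz_grad f (l : R) : Prop :=
  forall u v, enorm (grad f u - grad f v) <= l * enorm (u - v).

Definition subdifferential (h : 'rV[R]_d -> \bar R) u : set 'rV[R]_d :=
  [set s | forall v, (h u + (dot s (v - u))%:E <= h v)%E].

End euclidean.

Definition argmin {T : Type} {disp : Order.disp_t} {O : porderType disp}
    (F : T -> O) (A : set T) : set T :=
  [set u | A u /\ forall v, A v -> (F u <= F v)%O].

Section problem.
Context {R : realType} {d N : nat}.
Notation V := 'rV[R]_d.
Context (Z : set V) (g : 'I_N -> V -> R) (g0 p : V -> R).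

Definition gmean (z : V) : R := N%:R^-1 * \sum_(i < N) g i z.

Definition objective (z : V) : R := gmean z + g0 z + p z.

Definition indicator (z : V) : \bar R := if z \in Z then 0%E else +oo%E.

Definition hfun (z : V) : \bar R := (indicator z + (p z)%:E)%E.

(* The N blocks x_i and lambda_i are the rows of N x d matrices. *)
Definition aug_lagrangian (eta : 'I_N -> R) (x : 'M[R]_(N, d)) (z : V)
    (lam : 'M[R]_(N, d)) : \bar R :=
  ((\sum_(i < N) (N%:R^-1 * g i (row i x) + dot (row i lam) (row i x - z)
                  + eta i / 2 * enorm (row i x - z) ^+ 2)
    + g0 z)%:E + hfun z)%E.

Definition stationary (x : 'M[R]_(N, d)) (z : V) (lam : 'M[R]_(N, d)) : Prop :=
  (forall i, row i x = z /\
             N%:R^-1 *: grad (g i) (row i x) + row i lam = 0) /\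
  (exists2 s, subdifferential hfun z s &
              0 = grad g0 z - \sum_(i < N) row i lam + s).

Section algorithm.
Context (alpha eta : 'I_N -> R).

Definition block_model (i : 'I_N) (xi z lami : V) : R :=
  N%:R^-1 * g i z + N%:R^-1 * dot (grad (g i) z) (xi - z)
  + dot lami (xi - z) + alpha i * eta i / 2 * enorm (xi - z) ^+ 2.

(* One sample path, driven by the picked indices [i_ r], r >= 1.  Values at
   time 0, and [x 1], are not constrained: the method does not use them. *)
Record nestt_g (z1 : V) (y0 : 'I_N -> V) (i_ : nat -> 'I_N)
    (x : nat -> 'M[R]_(N, d)) (z : nat -> V) (lam : nat -> 'M[R]_(N, d)) :
    Prop := NesttG {
  nestt_z1 : z 1%N = z1;
  nestt_lam1 : forall i, row i (lam 1%N) = - (N%:R^-1 *: grad (g i) (y0 i));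
  nestt_x_picked : forall r, (1 <= r)%N ->
    argmin (fun xi => block_model (i_ r) xi (z r) (row (i_ r) (lam r))) setT
      (row (i_ r) (x r.+1));
  nestt_x_other : forall r j, (1 <= r)%N -> j != i_ r ->
    row j (x r.+1) = z r;
  nestt_lam_picked : forall r, (1 <= r)%N ->
    row (i_ r) (lam r.+1) = row (i_ r) (lam r)
      + (alpha (i_ r) * eta (i_ r)) *: (row (i_ r) (x r.+1) - z r);
  nestt_lam_other : forall r j, (1 <= r)%N -> j != i_ r ->
    row j (lam r.+1) = row j (lam r);
  nestt_z : forall r, (1 <= r)%N ->
    argmin (fun u => aug_lagrangian eta (x r.+1) u (lam r)) Z (z r.+1)
}.

Fixpoint memory (y0 : 'I_N -> V) (i_ : nat -> 'I_N) (z : nat -> V) (r : nat)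
    : 'I_N -> V :=
  if r is r'.+1 then
    fun j => if j == i_ r then z r else memory y0 i_ z r' j
  else y0.

Definition potential (prob : 'I_N -> R) (y0 : 'I_N -> V) (i_ : nat -> 'I_N)
    (z : nat -> V) (r : nat) : \bar R :=
  ((\sum_(i < N) N%:R^-1 * g i (z r)
    + \sum_(i < N) 3 * prob i * eta i / (alpha i * eta i) ^+ 2 *
        enorm (N%:R^-1 *: (grad (g i) (memory y0 i_ z r.-1 i)
                           - grad (g i) (z r))) ^+ 2
    + g0 (z r))%:E + hfun (z r))%E.

End algorithm.

(* [p] convex lsc and [Z] closed, convex, nonempty make the minimizer exist and
   be unique; the default value of [get] is then not used. *)
Definition prox (gam : R) (v : V) : V :=
  get (argmin (fun u => p u + gam / 2 * enorm (v - u) ^+ 2) Z).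

Definition prox_grad (gam : R) (z : V) : V :=
  gam *: (z - prox gam (z - gam^-1 *: grad (fun u => gmean u + g0 u) z)).

Definition gap (beta : R) (z : V) : R := enorm (prox_grad beta^-1 z) ^+ 2.

End problem.

Section sampling.
Context {R : realType} {disp : measure_display} {T : measurableType disp}.
Context (P : probability T R) {N : nat}.

(* The initial data being deterministic, the events of this form (n and j vary)
   generate everything the algorithm does before iteration n. *)
Definition past (i_ : nat -> T -> 'I_N) (n : nat) (j : nat -> 'I_N) : set T :=
  [set w | forall s, (1 <= s < n)%N -> i_ s w = j s].

Definition sampling (prob : 'I_N -> R) (i_ : nat -> T -> 'I_N) : Prop :=
  forall r, (1 <= r)%N -> forall k : 'I_N,
  [/\ measurable [set w | i_ r w = k],
      P [set w | i_ r w = k] = (prob k)%:E &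
      forall j, P ([set w | i_ r w = k] `&` past i_ r j) =
                (P [set w | i_ r w = k] * P (past i_ r j))%E].

Definition uniform_index (K : nat) (m : T -> nat) : Prop :=
  (forall w, (1 <= m w <= K)%N) /\
  (forall k, (1 <= k <= K)%N ->
     measurable [set w | m w = k] /\
     P [set w | m w = k] = (K%:R^-1)%:E).

Definition independent_index (m : T -> nat) (i_ : nat -> T -> 'I_N) : Prop :=
  forall k n j, P ([set w | m w = k] `&` past i_ n j) =
                (P [set w | m w = k] * P (past i_ n j))%E.

End sampling.

(* Main.v *)
Require Import Defs.
From HB Require Import structures.
From mathcomp Require Import all_boot all_order all_algebra.
From mathcomp Require Import all_classical all_reals all_analysis.
From mathcomp Require Import ring lra.
Import Order.TTheory GRing.Theory Num.Theory numFieldNormedType.Exports.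
Set Implicit Arguments.
Unset Strict Implicit.
Unset Printing Implicit Defensive.
Local Open Scope classical_set_scope.
Local Open Scope ring_scope.

(* Put M = S^2 and q = alpha = prob; then L_k / N = M q_k^2, eta_k = 3 M q_k,
   the eta_k sum up to 3 M = 1 / beta, and both grad g and grad g0 are Lipschitz
   with constant sigma = sum_k M q_k^2 <= M. Each multiplier stores a past
   gradient, lambda_k = - grad g_k (y_k) / N, so that with the stale differences
   D_k = (grad g_k (y_k) - grad g_k (z)) / N the z-update is a proximal step along
   an unbiased estimator of grad g (z), whose error is D_k / q_k - sum_j D_j when
   block k is picked.

   Let zh be the proximal point defining G, so G = 9 M^2 |zh - z|^2. Comparing
   the strongly convex z-subproblem at the new iterate z_k and at zh gives
     f z - f z_k >= (3 M - sigma) / 2 * (|zh - z|^2 + |z_k - zh|^2 + |z_k - z|^2)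
                    - <error_k, z_k - zh>,
   and averaging over k, the variance of the error is at most
   M sum_k |D_k|^2 / (M q_k). The second term of the potential decreases on
   average by 2/5 of that sum, up to a multiple of |z_k - z|^2 which the quadratic
   terms above absorb. Hence (80/3) M times the conditional expected decrease of
   Q dominates G, the primal residual, M^2 |z_k - z|^2 and a multiple of the D_k.
   Summing over r gives the two bounds; since Q >= inf f, the same inequality makes
   all these quantities summable, hence vanishing, almost surely, and by continuity
   they vanish at every limit point.

   A statement about r iterations involves only finitely many histories, each of
   positive probability, so expectations are weighted sums over histories evaluated
   at chosen sample points. *)

(** * Real inequalities and cluster points *)

Lemma ler_add_vanishing (R : realFieldType) (a b c : R) :
  (forall t, 0 < t -> t <= 1 -> a <= b + t * c) -> a <= b.
Proof.
move=> h; apply/ler_addgt0Pr => e e0.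
have c1 : 0 < `|c| + 1 by rewrite ltr_wpDl.
(* This [t] makes the extra term at most [e]; the added 1 covers [c = 0]. *)
pose t := Num.min 1 (e / (`|c| + 1)).
have t0 : 0 < t by rewrite lt_min ltr01 divr_gt0.
apply: le_trans (h t t0 _) _; first by rewrite ge_min lexx.
rewrite lerD2l; apply: le_trans (ler_norm _) _; rewrite normrM (gtr0_norm t0).
apply: (@le_trans _ _ (t * (`|c| + 1))); first by rewrite ler_pM2l// lerDl.
by rewrite -ler_pdivlMr// ge_min lexx orbT.
Qed.

Lemma ereal_inf_lower_bound (R : realType) (A : set R) :
  A !=set0 -> (-oo < ereal_inf [set u%:E | u in A])%E ->
  exists b, forall u, A u -> b <= u.
Proof.
move=> [u0 Au0]; case E : (ereal_inf _) => [b||]// _.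
  by exists b => u Au; rewrite -lee_fin -E; apply: ereal_inf_lbound; exists u.
suff : (+oo <= u0%:E)%E by [].
by rewrite -E; apply: ereal_inf_lbound; exists u0.
Qed.

(** If [f a] differed from [c], the balls around them of half their distance would have disjoint
    preimages, one a neighbourhood of [a], the other containing a tail of [u]. No subsequence is
    extracted. *)
Lemma cluster_limit (R : realType) (U : topologicalType) (u : nat -> U)
    (f : U -> R) (a : U) (c : R) :
  cluster (u @ \oo) a -> {for a, continuous f} -> f (u r) @[r --> \oo] --> c -> f a = c.
Proof.
move=> ua fa fu; apply/eqP; apply: contraT => ne.
have e0 : 0 < `|f a - c| / 2 by rewrite divr_gt0// normr_gt0 subr_eq0.
have h1 : \forall v \near a, `|f a - f v| < `|f a - c| / 2.
  by move/cvgrPdist_lt : fa; apply.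
have h2 : (u @ \oo) [set v | `|c - f v| < `|f a - c| / 2].
  by move/cvgrPdist_lt : fu => /(_ _ e0).
have [v [/= v2 v1]] := ua _ _ h2 h1.
have : `|f a - c| <= `|f a - f v| + `|c - f v|.
  by rewrite (distrC c); apply: le_trans (ler_normD _ _); rewrite addrA subrK.
by lra.
Qed.

Lemma row_continuous (R : realType) (N d : nat) (i : 'I_N) :
  continuous (row i : 'M[R]_(N, d) -> 'rV[R]_d).
Proof.
move=> A B [C AC CB].
(* Neighbourhoods of a matrix are generated by entrywise ones; the rows other than [i] are left
   free. *)
exists (fun k j => if k == i then C 0 j else setT).
  by move=> k j; case: eqVneq => [->|_]; [have := AC 0 j; rewrite mxE|exact: filterT].
by move=> D /= DC; apply: CB => k j; rewrite ord1 mxE; have := DC i j; rewrite eqxx.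
Qed.

(** * Euclidean geometry and gradients *)

Section euclidean.
Context {R : realType} {d : nat}.
Implicit Types (u v w : 'rV[R]_d).

Lemma dotC u v : dot u v = dot v u.
Proof. by apply: eq_bigr => j _; rewrite mulrC. Qed.

Lemma dotDl u v w : dot (u + v) w = dot u w + dot v w.
Proof. by rewrite -big_split; apply: eq_bigr => j _; rewrite mxE mulrDl. Qed.

Lemma dotZl a u w : dot (a *: u) w = a * dot u w.
Proof. by rewrite mulr_sumr; apply: eq_bigr => j _; rewrite mxE mulrA. Qed.

Lemma dotDr u v w : dot w (u + v) = dot w u + dot w v.
Proof. by rewrite ![dot w _]dotC dotDl. Qed.

Lemma dotZr a u w : dot w (a *: u) = a * dot w u.
Proof. by rewrite ![dot w _]dotC dotZl. Qed.

Lemma dotNl u w : dot (- u) w = - dot u w.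
Proof. by rewrite -scaleN1r dotZl mulN1r. Qed.

Lemma dotNr u w : dot w (- u) = - dot w u.
Proof. by rewrite dotC dotNl dotC. Qed.

Lemma dot0l w : dot 0 w = 0.
Proof. by rewrite -(scale0r 0) dotZl mul0r. Qed.

Lemma dot0r w : dot w 0 = 0.
Proof. by rewrite dotC dot0l. Qed.

Definition dotE := (dotDl, dotDr, dotNl, dotNr, dotZl, dotZr, dot0l, dot0r).

Lemma dot_suml (I : Type) (s : seq I) (P : pred I) (F : I -> 'rV[R]_d) w :
  dot (\sum_(i <- s | P i) F i) w = \sum_(i <- s | P i) dot (F i) w.
Proof. by elim/big_rec2: _ => [|i y1 y2 _ <-]; rewrite ?dot0l ?dotDl. Qed.

Lemma dot_ge0 u : 0 <= dot u u.
Proof. by apply: sumr_ge0 => j _; rewrite -expr2 sqr_ge0. Qed.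

Lemma dot_eq0 u : dot u u = 0 -> u = 0.
Proof.
move/eqP; rewrite psumr_eq0 => [/allP u0|j _]; last by rewrite -expr2 sqr_ge0.
apply/rowP => j; have := u0 j (mem_index_enum _).
by rewrite mulf_eq0 orbb mxE => /eqP.
Qed.

Lemma enorm_ge0 u : 0 <= enorm u.
Proof. exact: sqrtr_ge0. Qed.

Lemma sqr_enorm u : enorm u ^+ 2 = dot u u.
Proof. by rewrite sqr_sqrtr // dot_ge0. Qed.

Lemma enorm_le u c : 0 <= c -> (enorm u <= c) = (dot u u <= c ^+ 2).
Proof. by move=> c0; rewrite -sqr_enorm ler_sqr ?nnegrE// enorm_ge0. Qed.

(** Expand |a u - v|^2 >= 0 and divide by a. *)
Lemma dot_young (a : R) u v : 0 < a ->
  2 * dot u v <= a * dot u u + a^-1 * dot v v.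
Proof.
move=> a0; have := dot_ge0 (a *: u - v); rewrite !dotE (dotC v u) => h.
rewrite -(ler_pM2l a0) mulrDr mulVKf ?gt_eqF//; lra.
Qed.

Lemma dot_cauchy u v : `|dot u v| <= enorm u * enorm v.
Proof.
rewrite -ler_sqr ?nnegrE ?mulr_ge0 ?enorm_ge0//.
rewrite real_normK ?num_real// exprMn !sqr_enorm.
have [v0|v0] := eqVneq (dot v v) 0.
  by rewrite (dot_eq0 v0) !dotE expr0n mulr0.
have vgt : 0 < dot v v by rewrite lt_def v0 dot_ge0.
have := dot_ge0 (dot v v *: u - dot u v *: v).
rewrite !dotE (dotC v u) => h.
rewrite -(ler_pM2l vgt); lra.
Qed.

Lemma enormD u v : enorm (u + v) <= enorm u + enorm v.
Proof.
rewrite enorm_le ?addr_ge0 ?enorm_ge0// sqrrD !sqr_enorm !dotE (dotC v u).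
have := le_trans (ler_norm _) (dot_cauchy u v); lra.
Qed.

Lemma enormZ a u : enorm (a *: u) = `|a| * enorm u.
Proof.
apply/eqP; rewrite -(@eqrXn2 _ 2) ?mulr_ge0 ?enorm_ge0//; apply/eqP.
by rewrite exprMn !sqr_enorm real_normK ?num_real// !dotE mulrA -expr2.
Qed.

Lemma enormN u : enorm (- u) = enorm u.
Proof. by rewrite -scaleN1r enormZ normrN1 mul1r. Qed.

Lemma enorm0 : enorm (0 : 'rV[R]_d) = 0.
Proof. by rewrite /enorm dot0l sqrtr0. Qed.

Lemma enorm_sum (I : Type) (s : seq I) (F : I -> 'rV[R]_d) :
  enorm (\sum_(i <- s) F i) <= \sum_(i <- s) enorm (F i).
Proof.
elim/big_rec2: _ => [|i y1 y2 _ h]; first by rewrite enorm0.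
by apply: le_trans (enormD _ _) _; rewrite lerD2l.
Qed.

(** The topology is that of the sup norm; this bound carries Euclidean estimates over to it. *)
Lemma norm_le_enorm u : `|u| <= enorm u.
Proof.
rewrite -[leLHS]/(mx_norm u) /Num.norm/= mx_normrE.
apply/bigmax_leP; split; first exact: enorm_ge0.
move=> [i j] _ /=; rewrite ord1 -ler_sqr ?nnegrE ?enorm_ge0//.
rewrite real_normK ?num_real// sqr_enorm /dot (bigD1 j)//= -expr2 lerDl.
by apply: sumr_ge0 => k _; rewrite -expr2 sqr_ge0.
Qed.

Lemma dot_continuous (U : topologicalType) (f g : U -> 'rV[R]_d) (x : U) :
  {for x, continuous f} -> {for x, continuous g} ->
  {for x, continuous (fun t => dot (f t) (g t))}.
Proof.
move=> cf cg; apply: cvg_big => [|j _]; first exact: add_continuous.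
apply: cvgM.
  exact: (continuous_comp cf (@coord_continuous _ _ _ 0 j _)).
exact: (continuous_comp cg (@coord_continuous _ _ _ 0 j _)).
Qed.

Lemma enorm_continuous : continuous (@enorm R d).
Proof.
move=> u; apply: continuous_comp; last exact: sqrt_continuous.
by apply: (@dot_continuous 'rV[R]_d id id u); exact: cvg_id.
Qed.

Lemma enorm_lipschitz_continuous (f : 'rV[R]_d -> 'rV[R]_d) (c : R) :
  (forall u v, enorm (f u - f v) <= c * enorm (u - v)) -> continuous f.
Proof.
move=> fc u; apply/(@cvgrPdist_le _ _ _ _ (nbhs_filter u)) => e e0.
have : {for u, continuous (fun v => c * enorm (u - v))}.
  move=> /=; apply: (@cvgM _ _ (nbhs u) (nbhs_filter u) (fun=> c)).
    exact: (@cvg_cst _ _ _ _ (nbhs_filter u)).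
  apply: (@continuous_comp _ _ _ (fun v => u - v)); last exact: enorm_continuous.
  apply: (@continuousB _ _ _ (fun=> u) id); last exact: cvg_id.
  exact: (@cvg_cst _ _ _ _ (nbhs_filter u)).
move=> /(@cvgrPdist_le _ _ _ _ (nbhs_filter u)) /(_ e e0); rewrite subrr enorm0 mulr0.
apply: filterS => v; rewrite sub0r normrN => h.
apply: le_trans (norm_le_enorm _) _; apply: le_trans (fc _ _) _.
exact: le_trans (ler_norm _) h.
Qed.

End euclidean.

(** * Gradients and the quadratic upper bound *)

Section gradient.
Context {R : realType} {d : nat}.
Implicit Types (u v w : 'rV[R]_d) (f : 'rV[R]_d -> R).

Lemma derive_grad f u v : differentiable f u -> 'D_v f u = dot (grad f u) v.
Proof.
move=> df; rewrite deriveE// {1}(row_sum_delta v) linear_sum/=.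
by apply: eq_bigr => j _; rewrite linearZ/= mxE deriveE// mulrC.
Qed.

Lemma gradD f1 f2 u : differentiable f1 u -> differentiable f2 u ->
  grad (fun w => f1 w + f2 w) u = grad f1 u + grad f2 u.
Proof.
by move=> d1 d2; apply/rowP => j; rewrite !mxE deriveD//; apply: diff_derivable.
Qed.

Lemma gradZ f u (c : R) : differentiable f u ->
  grad (fun w => c * f w) u = c *: grad f u.
Proof.
by move=> df; apply/rowP => j; rewrite !mxE (deriveZ c)//; apply: diff_derivable.
Qed.

Lemma grad_sum (n : nat) (g : 'I_n -> 'rV[R]_d -> R) u :
  (forall i, differentiable (g i) u) ->
  grad (fun w => \sum_(i < n) g i w) u = \sum_(i < n) grad (g i) u.
Proof.
move=> dg; apply/rowP => j; rewrite summxE mxE.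
transitivity ('D_(delta_mx 0 j) (\sum_(i < n) g i) u).
  by congr (derive _ _ _); apply/funext => w; rewrite fct_sumE.
rewrite derive_sum; last by move=> i; apply: diff_derivable.
by apply: eq_bigr => i _; rewrite mxE.
Qed.

(* The function [t |-> f (u + t (v - u)) - t <grad f u, v - u> - l t^2/2 |v-u|^2]
   is nonincreasing on [0, 1]. *)
Lemma lipschitz_grad_le f (l : R) u v :
  (forall w, differentiable f w) -> lipschitz_grad f l ->
  f v <= f u + dot (grad f u) (v - u) + l / 2 * dot (v - u) (v - u).
Proof.
move=> df lf; set e := v - u.
pose phi (t : R) := f (u + t *: e) - t * dot (grad f u) e - l / 2 * t ^+ 2 * dot e e.
pose dphi (t : R) := dot (grad f (u + t *: e)) e - dot (grad f u) e - l * t * dot e e.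
have dline (t : R) : is_derive t 1 (fun t : R => f (u + t *: e)) (dot (grad f (u + t *: e)) e).
  have E : (fun h : R => h^-1 *:
        (((fun s => f (u + s *: e)) \o shift t) (h *: 1) - f (u + t *: e)))
      = (fun h => h^-1 *: ((f \o shift (u + t *: e)) (h *: e) - f (u + t *: e))).
    apply/funext => h /=; congr (_ *: (f _ - _)).
    by rewrite [h%:A]mulr1 scalerDl addrCA.
  have D : derivable f (u + t *: e) e by apply: diff_derivable.
  by split; [rewrite /derivable E|rewrite /derive E -derive_grad].
have dphiE (t : R) : is_derive t 1 phi (dphi t).
  apply: is_derive_eq.
  by rewrite /dphi /GRing.scale/=; field.
have cphi : {within `[0, 1], continuous phi}.
  apply: continuous_subspaceT => t; apply: differentiable_continuous.
  by apply/derivable1_diffP; have := dphiE t => ?; apply: ex_derive.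
have [c /[!in_itv]/= /andP[c0 c1]] := MVT (@ltr01 R) (fun t _ => dphiE t) cphi.
rewrite subr0 mulr1 /phi scale1r scale0r addr0 mul0r subr0 expr0n /=.
rewrite !mulr0 !mul0r subr0 expr1n mulr1 mul1r.
rewrite {1}/e subrKC.
suff : dphi c <= 0 by lra.
rewrite /dphi -subr_le0.
have := le_trans (ler_norm _) (dot_cauchy (grad f (u + c *: e) - grad f u) e).
have := lf (u + c *: e) u; rewrite addrAC subrr add0r enormZ (ger0_norm (ltW c0)) => h1 h2.
have := ler_wpM2r (enorm_ge0 e) h1.
rewrite -(sqr_enorm e) expr2; move: h2; rewrite dotDl dotNl; lra.
Qed.

End gradient.

(** * Minimization of strongly convex functions *)

Section strong_convexity.
Context {R : realType} {d : nat}.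
Notation V := 'rV[R]_d.
Implicit Types (Z : set V) (F G : V -> R).

(** The modulus may be negative: a smooth nonconvex function has minus its Lipschitz constant as
    modulus, and moduli add up under sums. *)
Definition strongly_convex Z F (mu : R) := forall u v (t : R), Z u -> Z v ->
  0 <= t -> t <= 1 ->
  F (t *: u + (1 - t) *: v) <=
    t * F u + (1 - t) * F v - mu / 2 * (t * (1 - t)) * dot (u - v) (u - v).

Definition real_lsc F := forall u a, a < F u -> \forall v \near u, a < F v.

Lemma strongly_convexD Z F G mu nu : strongly_convex Z F mu ->
  strongly_convex Z G nu -> strongly_convex Z (fun u => F u + G u) (mu + nu).
Proof.
move=> cF cG u v t Zu Zv t0 t1.
have := cF u v t Zu Zv t0 t1; have := cG u v t Zu Zv t0 t1; lra.
Qed.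

Lemma convex_strongly_convex Z F : convex_function setT F -> strongly_convex Z F 0.
Proof.
move=> cF u v t _ _ t0 t1.
have := cF (Itv01 t0 t1) u v (in_setT _) (in_setT _); rewrite convRE /=.
by rewrite mul0r mul0r mul0r subr0.
Qed.

Lemma affine_strongly_convex Z (a z : V) (c : R) :
  strongly_convex Z (fun u => dot a (u - z) + c / 2 * dot (u - z) (u - z)) c.
Proof.
move=> u v t _ _ _ _; rewrite !dotE.
rewrite (dotC z u) (dotC z v) (dotC v u) le_eqVlt; apply/orP; left; apply/eqP.
by field.
Qed.

(** The bound of [lipschitz_grad_le] for -F, taken from w towards u and v, is averaged with weights
    t and 1 - t; the linear terms cancel because t (u - w) + (1 - t) (v - w) = 0. *)
Lemma lipschitz_grad_strongly_convex Z F (l : R) :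
  (forall u, differentiable F u) -> lipschitz_grad F l ->
  strongly_convex Z F (- l).
Proof.
move=> dF lF u v t _ _ t0 t1; set w := t *: u + _.
have lNF : lipschitz_grad (fun x => (-1) * F x) l.
  move=> x y; rewrite !gradZ// -scalerBr enormZ normrN1 mul1r; exact: lF.
have dNF x : differentiable (fun x => (-1) * F x) x by apply: differentiableZ.
have hu := lipschitz_grad_le w u dNF lNF.
have hv := lipschitz_grad_le w v dNF lNF.
have eu : u - w = (1 - t) *: (u - v).
  by rewrite /w scalerBr scalerBl scale1r; apply/rowP => j; rewrite !mxE; ring.
have ev : v - w = (- t) *: (u - v).
  by rewrite /w; apply/rowP => j; rewrite !mxE; ring.
rewrite !gradZ// eu ev !dotZl !dotZr in hu hv.
have := ler_wpM2l t0 hu.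
have t1' : 0 <= 1 - t by lra.
have := ler_wpM2l t1' hv.
nra.
Qed.

Lemma convex_setE Z u v (t : R) : convex_set Z -> Z u -> Z v -> 0 <= t -> t <= 1 ->
  Z (t *: u + (1 - t) *: v).
Proof.
move=> cZ Zu Zv t0 t1.
by have := cZ u v (Itv01 t0 t1) (mem_set Zu) (mem_set Zv); rewrite inE.
Qed.

(** Minimality is tested at t v + (1 - t) u; the resulting inequality is divided by t, and t tends
    to 0. *)
Lemma argmin_strong Z F (mu : R) u v : convex_set Z -> strongly_convex Z F mu ->
  argmin F Z u -> Z v -> F u + mu / 2 * dot (v - u) (v - u) <= F v.
Proof.
move=> cZ cF [Zu Fu] Zv.
apply: (@ler_add_vanishing _ _ _ (mu / 2 * dot (v - u) (v - u))) => t t0 t1.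
have h1 := Fu _ (convex_setE cZ Zv Zu (ltW t0) t1).
have h2 := cF v u t Zv Zu (ltW t0) t1.
rewrite -subr_ge0 -(pmulr_rge0 _ t0); lra.
Qed.

Lemma argmin_uniq Z F (mu : R) u v : convex_set Z -> strongly_convex Z F mu ->
  0 < mu -> argmin F Z u -> argmin F Z v -> u = v.
Proof.
move=> cZ cF mu0 au av; apply/eqP; rewrite eq_sym -subr_eq0; apply/eqP/dot_eq0.
have h1 := argmin_strong cZ cF au (proj1 av).
have h2 := (proj2 av) _ (proj1 au).
apply/eqP; rewrite eq_le dot_ge0 andbT -(pmulr_rle0 _ mu0); lra.
Qed.

Lemma real_lsc_EFin F : lower_semicontinuous (EFin \o F) -> real_lsc F.
Proof.
move=> lF u a au; have [|W nW WP] := lF u a; first by rewrite lte_fin.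
by apply: filterS nW => v /WP; rewrite /= lte_fin.
Qed.

Lemma real_lsc_continuous F G : real_lsc F -> continuous G ->
  real_lsc (fun u => F u + G u).
Proof.
move=> lF cG u a au; set e := (F u + G u - a) / 2.
have e0 : 0 < e by rewrite /e; lra.
have lt1 : F u - e < F u by lra.
have lt2 : G u - e < G u by lra.
have nF := lF u _ lt1.
have nG : \forall v \near u, G u - e < G v.
  exact: (cG u) _ (lt_nbhsr lt2).
apply: filterS2 nF nG => v; rewrite /e; lra.
Qed.

(** Strong convexity at midpoints makes a minimizing sequence Cauchy, so completeness takes the
    place of compactness; the limit attains the infimum by lower semicontinuity. *)
Lemma argmin_exists Z F (mu b : R) : closed Z -> convex_set Z -> Z !=set0 ->
  strongly_convex Z F mu -> 0 < mu -> real_lsc F ->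
  (forall u, Z u -> b <= F u) -> argmin F Z !=set0.
Proof.
move=> clZ cZ Z0 cF mu0 lF bF.
pose I := inf [set F u | u in Z].
have I0 : has_inf [set F u | u in Z].
  split; first by have [u Zu] := Z0; exists (F u), u.
  by exists b => _ [u Zu <-]; exact: bF.
have IF u : Z u -> I <= F u by move=> Zu; apply: (ge_inf I0.2); exists u.
have /choice [u uP] : forall n : nat, exists u, Z u /\ F u < I + n.+1%:R^-1.
  move=> n; have n0 : (0 : R) < n.+1%:R^-1 by rewrite invr_gt0 ltr0n.
  by have [_ [u Zu <-] h] := inf_adherent n0 I0; exists u.
(* The midpoint of [u m] and [u n] has value at least [I]; strong convexity is used at t = 1/2. *)
have cau m n : mu / 4 * dot (u m - u n) (u m - u n) <= m.+1%:R^-1 + n.+1%:R^-1.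
  have [[Zm Fm] [Zn Fn]] := (uP m, uP n).
  have h0 : (0 : R) <= 2^-1 by lra.
  have h1 : (2^-1 : R) <= 1 by lra.
  have := cF _ _ _ Zm Zn h0 h1.
  have := IF _ (convex_setE cZ Zm Zn h0 h1).
  have e1 : (0 : R) < m.+1%:R^-1 by rewrite invr_gt0 ltr0n.
  have e2 : (0 : R) < n.+1%:R^-1 by rewrite invr_gt0 ltr0n.
  move: (m.+1%:R^-1) (n.+1%:R^-1) e1 e2 Fm Fn => a1 a2.
  move: (F (_ + _)) (dot _ _) => F0 D ? ? ? ? ? ?.
  nra.
have /cvg_ex[l ul] : cvg (u @ \oo).
  apply: cauchy_cvg; apply: cauchy_exP => e e0.
  (* Two reciprocals below mu e^2 / 8 add up to less than mu e^2 / 4, which [cau] forbids for points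
     at distance at least e. *)
  have e4 : 0 < mu / 8 * e ^+ 2 by rewrite mulr_gt0 ?exprn_gt0 ?divr_gt0.
  have [n _ nP] := near_infty_natSinv_lt (PosNum e4).
  exists (u n); exists n => // m nm /=.
  rewrite -ball_normE /ball_ /=; apply: le_lt_trans (norm_le_enorm _) _.
  rewrite ltNge; apply/negP => h.
  have := cau n m; have := nP n (leqnn n); have := nP m nm; rewrite /=.
  have : e ^+ 2 <= dot (u n - u m) (u n - u m).
    by rewrite -sqr_enorm ler_sqr ?nnegrE ?enorm_ge0// ltW.
  by move: (m.+1%:R^-1) (n.+1%:R^-1) => a1 a2; rewrite -(ler_pM2l mu0); lra.
have Zl : Z l by apply: (closed_cvg Z clZ _ _ ul); apply: nearW => n; exact: (uP n).1.
exists l; split=> // v Zv; apply: le_trans (IF _ Zv).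
rewrite leNgt; apply/negP => Il.
have e0 : 0 < (F l - I) / 2 by lra.
have lt1 : (F l + I) / 2 < F l by lra.
have near1 : \forall n \near \oo, (F l + I) / 2 < F (u n) := ul _ (lF _ _ lt1).
have near2 := near_infty_natSinv_lt (PosNum e0).
have [n [h1 h2]] := filter_ex (filterI near1 near2).
by have := (uP n).2; move: h1 h2 => /=; move: (n.+1%:R^-1) => a1; lra.
Qed.

(** The test point is the true minimizer v - a / c; 2c times the excess of the value at u over the
    value there is |c (u - v) + a|^2, hence at most 0. *)
Lemma quadratic_argmin (a u v : V) (b c : R) : 0 < c ->
  argmin (fun w => b + dot a (w - v) + c / 2 * dot (w - v) (w - v)) setT u ->
  c *: (u - v) = - a.
Proof.
move=> c0 [_ /(_ (v - c^-1 *: a) I)]; rewrite [v - _ - v]addrAC subrr add0r => h.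
apply/eqP; rewrite -subr_eq0 opprK; apply/eqP/dot_eq0/eqP.
rewrite eq_le dot_ge0 andbT; move: h; rewrite -(ler_pM2l c0).
move: (u - v) => w; rewrite !dotE (dotC w a) => h.
suff -> : c * (c * dot w w + dot a w) + (c * dot a w + dot a a) =
  2 * (c * (b + dot a w + c / 2 * dot w w) - c * (b + - (c^-1 * dot a a) +
    c / 2 * - - (c^-1 * (c^-1 * dot a a)))).
  by move: h; rewrite !opprK; lra.
by field; rewrite gt_eqF.
Qed.

End strong_convexity.

(** * Proximal steps over a closed convex set *)

Section proximal_step.
Context {R : realType} {d : nat}.
Notation V := 'rV[R]_d.
Context (Z : set V) (p : V -> R) (gam : R).
Context (Z_closed : closed Z).
Context (Z_convex : convex_set Z).
Context (Z_nonempty : Z !=set0).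
Context (p_convex : convex_function setT p).
Context (p_lsc : real_lsc p).
Context (gam_gt0 : 0 < gam).
Context (p_below : forall v, exists b, forall u, Z u ->
  b <= p u + gam / 2 * dot (u - v) (u - v)).

Let sq (v : V) : (fun u => p u + gam / 2 * enorm (v - u) ^+ 2) =
  fun u => p u + (dot 0 (u - v) + gam / 2 * dot (u - v) (u - v)).
Proof. by apply/funext => u; rewrite sqr_enorm -opprB dotNl dotNr opprK dot0l add0r. Qed.

Lemma prox_argmin v :
  argmin (fun u => p u + gam / 2 * enorm (v - u) ^+ 2) Z (prox Z p gam v).
Proof.
apply: getPex; rewrite sq; have [b pb] := p_below v.
have := strongly_convexD (@convex_strongly_convex _ _ Z _ p_convex)
  (@affine_strongly_convex _ _ Z 0 v gam).
rewrite add0r => cF.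
apply: (@argmin_exists _ _ _ _ gam b) => //.
  apply: real_lsc_continuous => // u.
  have cB : {for u, continuous (fun w : V => w - v)}.
    apply: (@continuousB _ _ _ id (fun=> v)); first exact: cvg_id.
    exact: (@cvg_cst _ _ _ _ (nbhs_filter u)).
  have c0 : {for u, continuous (fun=> 0 : V)} by exact: (@cvg_cst _ _ _ _ (nbhs_filter u)).
  have cg : {for u, continuous (fun=> gam / 2)} by exact: (@cvg_cst _ _ _ _ (nbhs_filter u)).
  exact: (continuousD (dot_continuous c0 cB) (continuousM cg (dot_continuous cB cB))).
by move=> u Zu; have := pb u Zu; rewrite dot0l; lra.
Qed.

Lemma prox_strong v u : Z u ->
  p (prox Z p gam v) + gam / 2 * dot (prox Z p gam v - v) (prox Z p gam v - v)
    + gam / 2 * dot (u - prox Z p gam v) (u - prox Z p gam v)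
  <= p u + gam / 2 * dot (u - v) (u - v).
Proof.
move=> Zu; have := strongly_convexD (@convex_strongly_convex _ _ Z _ p_convex)
  (@affine_strongly_convex _ _ Z 0 v gam).
rewrite add0r => cF; have := prox_argmin v.
rewrite sq => /(argmin_strong Z_convex cF) /(_ Zu); rewrite !dot0l; lra.
Qed.

(** Quadratic growth at each of the two prox points a, b, tested at the other and added, gives |a -
    b|^2 <= <v - w, a - b>; Cauchy-Schwarz concludes. *)
Lemma prox_nonexpansive v w :
  enorm (prox Z p gam v - prox Z p gam w) <= enorm (v - w).
Proof.
have := prox_strong v (proj1 (prox_argmin w)).
have := prox_strong w (proj1 (prox_argmin v)).
set a := prox _ _ _ v; set b := prox _ _ _ w => h1 h2.
have h : gam * dot (a - b) (a - b) <= gam * dot (v - w) (a - b).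
  move: h1 h2; rewrite !dotE (dotC b a) (dotC v a) (dotC w b) (dotC v b) (dotC w a); lra.
rewrite ler_pM2l// in h.
have := le_trans h (le_trans (ler_norm _) (dot_cauchy _ _)).
rewrite -sqr_enorm expr2.
have [->|n0] := eqVneq (enorm (a - b)) 0; first by rewrite enorm_ge0.
by rewrite ler_pM2r// lt_def n0 enorm_ge0.
Qed.

Context (c : V -> V).

Definition prox_point (z : V) : V := prox Z p gam (z - gam^-1 *: c z).

Lemma prox_point_in z : Z (prox_point z).
Proof. exact: (proj1 (prox_argmin _)). Qed.

(** Completing the square: centring the quadratic at z - c(z) / gam adds the linear term <c(z), u -
    z> and the constant |c(z)|^2 / (2 gam). *)
Lemma prox_point_strong z u : Z u ->
  p (prox_point z) + dot (c z) (prox_point z - z)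
    + gam / 2 * dot (prox_point z - z) (prox_point z - z)
    + gam / 2 * dot (u - prox_point z) (u - prox_point z)
  <= p u + dot (c z) (u - z) + gam / 2 * dot (u - z) (u - z).
Proof.
move=> Zu; have := prox_strong (z - gam^-1 *: c z) Zu.
rewrite -/(prox_point z); set a := prox_point z; set b := c z.
have E w : gam / 2 * dot (w - (z - gam^-1 *: b)) (w - (z - gam^-1 *: b)) =
  gam / 2 * dot (w - z) (w - z) + dot b (w - z) + (2 * gam)^-1 * dot b b.
  rewrite !dotE (dotC w b) (dotC z b) (dotC z w); field.
  by rewrite gt_eqF.
by rewrite !E; lra.
Qed.

Lemma prox_point_continuous (l : R) :
  (forall u v, enorm (c u - c v) <= l * enorm (u - v)) -> continuous prox_point.
Proof.
move=> lc; apply: (@enorm_lipschitz_continuous _ _ _ (1 + gam^-1 * l)) => u v.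
apply: le_trans (prox_nonexpansive _ _) _.
rewrite (_ : _ - _ = (u - v) + (- gam^-1) *: (c u - c v)); last first.
  by apply/rowP => j; rewrite !mxE; ring.
apply: le_trans (enormD _ _) _; rewrite enormZ normrN gtr0_norm ?invr_gt0//.
by rewrite mulrDl mul1r lerD2l -mulrA ler_pM2l ?invr_gt0.
Qed.

End proximal_step.

(** * Averaging over the sampled block *)

Section one_step.
Context {R : realType} {d N : nat}.
Notation V := 'rV[R]_d.
Context (M : R) (q : 'I_N -> R).
Context (M_gt0 : 0 < M).
Context (q_gt0 : forall k, 0 < q k).
Context (q_sum : \sum_(k < N) q k = 1).

(* Here [M] is S^2 and [q] is both alpha and the sampling law, so that
   L_k / N = M q_k^2, eta_k = 3 M q_k and 1/beta = 3 M. *)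
Let l (k : 'I_N) : R := M * q k ^+ 2.
Let sigma : R := \sum_(k < N) l k.

(** The potential weighs |D_k|^2 by 1 / (M q_k^2), and block k is refreshed with probability q_k;
    the product of the two is the weight here. *)
Definition spread (D : 'I_N -> V) : R :=
  \sum_(k < N) dot (D k) (D k) / (M * q k).

Let q_le1 k : q k <= 1.
Proof.
rewrite -q_sum (bigD1 k)//=.
by rewrite lerDl; apply: sumr_ge0 => j _; rewrite ltW.
Qed.

Lemma curvature_le : sigma <= M.
Proof.
rewrite -[leRHS]mulr1 -q_sum mulr_sumr; apply: ler_sum => k _.
by rewrite ler_pM2l// expr2 ler_piMr// ltW.
Qed.

Lemma spread_ge0 D : 0 <= spread D.
Proof.
by apply: sumr_ge0 => k _; rewrite divr_ge0 ?dot_ge0 ?mulr_ge0 ?ltW.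
Qed.

Lemma sum_other j : \sum_(k < N | k != j) q k = 1 - q j.
Proof. by rewrite -q_sum [in RHS](bigD1 j)//= addrAC subrr add0r. Qed.

(** The stale differences after picking k: [C k j] is the change of the j-th gradient caused by the
    move of z, and resetting y_k to z erases the old [D k]. *)
Definition refreshed (D : 'I_N -> V) (C : 'I_N -> 'I_N -> V) (k j : 'I_N) : V :=
  if j == k then C k j else D j + C k j.

Section drift.
Context (D : 'I_N -> V) (C : 'I_N -> 'I_N -> V) (e : 'I_N -> R).
Context (C_le : forall k j, dot (C k j) (C k j) <= l j ^+ 2 * e k).
Context (e_ge0 : forall k, 0 <= e k).

(* Young's inequality with weight (3/5) q_j / (1 - q_j) on the terms in which
   block j is not refreshed. *)
Lemma refreshed_block_drift j :
  \sum_(k < N) q k * dot (refreshed D C k j) (refreshed D C k j) <=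
  (1 - 2 / 5 * q j) * dot (D j) (D j) +
  l j ^+ 2 * (1 + 5 / 3 * (1 - q j) / q j) * \sum_(k < N) q k * e k.
Proof.
have [q0 l0] : 0 < q j /\ 0 <= l j ^+ 2 by rewrite sqr_ge0.
have c0 : 0 <= 5 / 3 * (1 - q j) / q j.
  by rewrite divr_ge0 ?mulr_ge0 ?divr_ge0 ?subr_ge0// ltW.
rewrite (bigD1 j)//= {1 2}/refreshed eqxx.
apply: (@le_trans _ _ (q j * (l j ^+ 2 * e j) + \sum_(k < N | k != j)
   (q k * ((1 + 3 / 5 * q j / (1 - q j)) * dot (D j) (D j)) +
    l j ^+ 2 * (1 + 5 / 3 * (1 - q j) / q j) * (q k * e k)))).
  apply: lerD; first by rewrite ler_pM2l.
  apply: ler_sum => k kj; rewrite /refreshed eq_sym (negbTE kj).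
  have q1 : 0 < 1 - q j.
    rewrite -sum_other (bigD1 k)//= ltr_pwDl//.
    by apply: sumr_ge0 => i _; rewrite ltW.
  have a0 : 0 < 3 / 5 * q j / (1 - q j) by rewrite divr_gt0// mulr_gt0.
  have := dot_young (D j) (C k j) a0.
  have -> : (3 / 5 * q j / (1 - q j))^-1 = 5 / 3 * (1 - q j) / q j.
    by field; rewrite !gt_eqF.
  move=> h; rewrite [X in _ <= _ + X]mulrCA -mulrDr ler_pM2l// dotDl !dotDr.
  rewrite (dotC (C k j) (D j)).
  have := ler_wpM2l c0 (C_le k j); have := C_le k j.
  move: h; lra.
rewrite big_split/= -mulr_suml sum_other -mulr_sumr [in leRHS](bigD1 j)//=.
set c := 5 / 3 * _ / _ in c0 *; set X := \sum_(k < N | _) _.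
have hB : q j * (l j ^+ 2 * e j) <= l j ^+ 2 * (1 + c) * (q j * e j).
  by rewrite mulrCA -mulrA ler_wpM2l// ler_peMl ?lerDl// mulr_ge0// ltW.
have hA : (1 - q j) * ((1 + 3 / 5 * q j / (1 - q j)) * dot (D j) (D j)) <=
    (1 - 2 / 5 * q j) * dot (D j) (D j).
  rewrite mulrA ler_wpM2r ?dot_ge0// mulrDr mulr1.
  (* With a single block 1 - q_j = 0, and the left side is 0. *)
  have [->|q1] := eqVneq (1 - q j) 0; last by rewrite mulrCA divff// mulr1; lra.
  by have := q_le1 j; lra.
rewrite [leRHS](_ : _ = (1 - 2 / 5 * q j) * dot (D j) (D j) + l j ^+ 2 * (1 + c) * (q j * e j)
  + l j ^+ 2 * (1 + c) * X); last by ring.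
by rewrite addrA lerD2r addrC lerD.
Qed.

(** The blockwise drifts are divided by l_j and summed; the factor of the last term is the sum of
    the l_j (1 + 5/3 (1 - q_j) / q_j), evaluated with sum q_j = 1. *)
Lemma refreshed_drift :
  \sum_(k < N) q k * (\sum_(j < N) dot (refreshed D C k j) (refreshed D C k j) / l j)
  <= \sum_(j < N) dot (D j) (D j) / l j - 2 / 5 * spread D
     + (5 / 3 * M - 2 / 3 * sigma) * \sum_(k < N) q k * e k.
Proof.
have EM : M = \sum_(j < N) M * q j by rewrite -mulr_sumr q_sum mulr1.
have -> : 5 / 3 * M - 2 / 3 * sigma =
    \sum_(j < N) l j * (1 + 5 / 3 * (1 - q j) / q j).
  rewrite {1}EM /sigma !mulr_sumr -sumrB.
  by apply: eq_bigr => j _; rewrite /l; field; rewrite gt_eqF.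
rewrite /spread mulr_sumr -sumrB mulr_suml -big_split/=.
under eq_bigr do rewrite mulr_sumr.
rewrite exchange_big/=; apply: ler_sum => j _.
have l0 : 0 < l j by rewrite mulr_gt0// exprn_gt0.
rewrite -(ler_pM2l l0); apply: le_trans (le_trans (refreshed_block_drift j) _).
  rewrite mulr_sumr le_eqVlt; apply/orP; left; apply/eqP.
  by apply: eq_bigr => k _; field; rewrite gt_eqF.
rewrite le_eqVlt; apply/orP; left; apply/eqP.
by rewrite /l; field; rewrite !gt_eqF.
Qed.

End drift.

(** D_k / q_k has mean sum_j D_j, so the variance is the second moment minus the square of the mean,
    which is dropped. *)
Lemma estimator_variance (D : 'I_N -> V) :
  \sum_(k < N) q k * dot ((q k)^-1 *: D k - \sum_(j < N) D j)
                        ((q k)^-1 *: D k - \sum_(j < N) D j) <= M * spread D.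
Proof.
set A := \sum_(j < N) D j.
have -> : M * spread D = \sum_(k < N) q k * dot ((q k)^-1 *: D k) ((q k)^-1 *: D k).
  rewrite mulr_sumr; apply: eq_bigr => k _; rewrite !dotE; field.
  by rewrite !gt_eqF.
suff -> : \sum_(k < N) q k * dot ((q k)^-1 *: D k - A) ((q k)^-1 *: D k - A) =
  \sum_(k < N) q k * dot ((q k)^-1 *: D k) ((q k)^-1 *: D k) - dot A A.
  by rewrite gerBl dot_ge0.
transitivity (\sum_(k < N) (q k * dot ((q k)^-1 *: D k) ((q k)^-1 *: D k)
  - 2 * dot (D k) A + q k * dot A A)).
  apply: eq_bigr => k _; rewrite !dotE (dotC A (D k)); field.
  by rewrite gt_eqF.
rewrite big_split/= sumrB -mulr_suml q_sum mul1r -mulr_sumr -dot_suml -/A; lra.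
Qed.

(** In the application a = zh - z, b_k = z_k - zh and c_k = z_k - z, where zh is the proximal point
    and z_k the iterate obtained with block k; f0 and f_k are the objective values at z and z_k. *)
Lemma expected_decrease (D : 'I_N -> V) (C : 'I_N -> 'I_N -> V)
    (f0 : R) (f : 'I_N -> R) (a : V) (b c : 'I_N -> V) :
  (forall k, c k = a + b k) ->
  (forall k j, dot (C k j) (C k j) <= l j ^+ 2 * dot (c k) (c k)) ->
  (forall k, f k <= f0
     - (3 * M - sigma) / 2 * (dot a a + dot (b k) (b k) + dot (c k) (c k))
     + dot ((q k)^-1 *: D k - \sum_(j < N) D j) (b k)) ->
  \sum_(k < N) q k * (9 * M ^+ 2 * dot a a + 3 * dot (D k) (D k) / q k ^+ 2
    + M ^+ 2 * dot (c k) (c k) + M / 5 * spread D) <=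
  80 / 3 * M * \sum_(k < N) q k *
    ((f0 + \sum_(j < N) dot (D j) (D j) / l j) -
     (f k + \sum_(j < N) dot (refreshed D C k j) (refreshed D C k j) / l j)).
Proof.
move=> cE C_le f_le.
have drift := refreshed_drift D C_le (fun k => dot_ge0 _).
pose del k := (q k)^-1 *: D k - \sum_(j < N) D j.
have var : \sum_(k < N) q k * dot (del k) (del k) <= M * spread D.
  exact: estimator_variance.
(* The first factor is the one that [refreshed_drift] charges to |c_k|^2, the second becomes M^2 (9
   |a|^2 + |c_k|^2) after multiplication by 80/3 M. Young's weight 9/5 M costs 9/10 M |b_k|^2, which
   (3M - sigma) / 2 >= M covers; |a - b_k|^2 >= 0 bounds |c_k|^2 by 2 |a|^2 + 2 |b_k|^2. *)
have step k : (5 / 3 * M - 2 / 3 * sigma) * dot (c k) (c k)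
    + 3 / 80 * M * (9 * dot a a + dot (c k) (c k))
    - 5 / 18 * M^-1 * dot (del k) (del k) <= f0 - f k.
  have M9 : 0 < 9 / 5 * M by rewrite mulr_gt0.
  have := dot_young (b k) (del k) M9; rewrite (dotC (b k)).
  have -> : (9 / 5 * M)^-1 = 5 / 9 * M^-1 by field; rewrite gt_eqF.
  have := f_le k; rewrite -/(del k).
  have := dot_ge0 (a - b k).
  have := curvature_le; have := dot_ge0 a; have := dot_ge0 (b k).
  rewrite cE !dotE (dotC (b k) a).
  move: (dot a a) (dot a (b k)) (dot (b k) (b k)) (dot (del k) (b k)) (dot (del k) (del k)).
  move=> A X B Y W B0 A0 sM h1 h2 h3.
  have M0 : 0 <= M - sigma by lra.
  have := mulr_ge0 M0 h1; have := mulr_ge0 M0 A0; have := mulr_ge0 M0 B0.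
  have := mulr_ge0 (ltW M_gt0) h1; have := mulr_ge0 (ltW M_gt0) A0.
  have := mulr_ge0 (ltW M_gt0) B0.
  move: h2 h3; lra.
have sumstep := ler_sum (index_enum 'I_N)
  (fun (k : 'I_N) (_ : true) => ler_wpM2l (ltW (q_gt0 k)) (step k)).
set E := fun X : 'I_N -> R => \sum_(k < N) q k * X k.
have EZ x X : E (fun k => x * X k) = x * E X.
  by rewrite /E mulr_sumr; apply: eq_bigr => k _; rewrite mulrCA.
have ED X Y : E (fun k => X k + Y k) = E X + E Y.
  by rewrite /E -big_split; apply: eq_bigr => k _; rewrite mulrDr.
have EN X : E (fun k => - X k) = - E X.
  by rewrite /E -sumrN; apply: eq_bigr => k _; rewrite mulrN.
have Ec x : E (fun=> x) = x by rewrite /E -mulr_suml q_sum mul1r.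
have ES : E (fun k => 3 * dot (D k) (D k) / q k ^+ 2) = 3 * M * spread D.
  rewrite /E /spread mulr_sumr; apply: eq_bigr => k _; field.
  by rewrite !gt_eqF.
rewrite -!/(E _) in var drift sumstep *.
rewrite !(ED, EN, EZ, Ec, ES) in var drift sumstep *.
have M1 : 0 < M^-1 by rewrite invr_gt0.
have := ler_wpM2l (ltW M1) var; rewrite mulKf ?gt_eqF// => var'.
(* 11/90 = 2/5 - 5/18: the drift less the variance. Times 80/3 M it exceeds 3M + M/5, where 3M pays
   for the average primal residual. *)
have h : 3 / 80 * M * (9 * dot a a + E (fun k => dot (c k) (c k))) + 11 / 90 * spread D <=
  f0 + \sum_(j < N) dot (D j) (D j) / l j -
   (E f + E (fun k => \sum_(j < N) dot (refreshed D C k j) (refreshed D C k j) / l j)).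
  by lra.
have := ler_wpM2l (ltW M_gt0) h; have := spread_ge0 D => sp.
have := mulr_ge0 (ltW M_gt0) sp; lra.
Qed.

End one_step.

(** * Finite sampling histories *)

Section finite_partition.
Context {R : realType} {disp : measure_display} {T : measurableType disp}.
Context (P : probability T R) {I : finType} (A : I -> set T) (w_ : I -> T).
Context (A_measurable : forall a, measurable (A a)).
Context (A_partition : forall w, exists a, forall b, A b w <-> b = a).

(** Such an X is a finite combination of indicators of cells; measurability and integrals of the
    iterates are obtained in this way. *)
Definition cellwise_constant (X : T -> R) := forall a w, A a w -> X w = X (w_ a).

Lemma cellwise_constantE X : cellwise_constant X ->
  X = fun w => \sum_(a : I) X (w_ a) * \1_(A a) w.
Proof.
move=> cX; apply/funext => w; have [a aP] := A_partition w.
rewrite (bigD1 a)//= big1 ?addr0; last first.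
  by move=> b ba; rewrite indicE memNset ?mulr0// => /aP /eqP; rewrite (negbTE ba).
have Aa : A a w by apply/aP.
by rewrite indicE mem_set// mulr1; exact: cX.
Qed.

Lemma cellwise_constant_measurable X : cellwise_constant X ->
  measurable_fun setT X.
Proof.
move=> /cellwise_constantE ->; apply: measurable_sum => a.
apply: measurable_realfun.measurable_funM; first exact: measurable_cst.
exact: measurable_realfun.measurable_indic.
Qed.

Lemma integral_cellwise_constant X : cellwise_constant X ->
  (\int[P]_w (X w)%:E = (\sum_(a : I) X (w_ a) * fine (P (A a)))%:E)%E.
Proof.
move=> /cellwise_constantE XE; rewrite {1}XE.
have int_indic a : P.-integrable setT (EFin \o \1_(A a)).
  exact: integrable_indic.
under eq_integral do rewrite -sumEFin.
rewrite integral_sum//; last first.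
  move=> a; under eq_fun do rewrite EFinM.
  by apply: integrableZl => //; exact: int_indic.
rewrite -sumEFin; apply: eq_bigr => a _.
under eq_integral do rewrite EFinM.
rewrite integralZl//; last exact: int_indic.
by rewrite integral_indic// setIT EFinM fineK ?fin_num_measure.
Qed.

End finite_partition.

(** * Probabilities of sampling histories *)

Section histories.
Context {R : realType} {disp : measure_display} {T : measurableType disp}.
Context (P : probability T R) {N : nat} (q : 'I_N -> R) (i_ : nat -> T -> 'I_N).
Context (q_gt0 : forall k, 0 < q k).
Context (q_sum : \sum_(k < N) q k = 1).
Context (i_sampling : sampling P q i_).

Lemma past1 (j : nat -> 'I_N) : past i_ 1 j = setT.
Proof. by apply/seteqP; split=> // w _ []. Qed.

Lemma pastS n (j : nat -> 'I_N) :
  past i_ n.+2 j = [set w | i_ n.+1 w = j n.+1] `&` past i_ n.+1 j.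
Proof.
apply/seteqP; split=> w /= => [h|[h1 h2] s /andP[s1]].
  by split=> [|s /andP[s1 sn]]; apply: h; rewrite ?ltnSn// s1 ltnW.
by rewrite ltnS leq_eqVlt => /predU1P[->//|sn]; apply: h2; rewrite s1.
Qed.

Lemma past_measurable n j : measurable (past i_ n.+1 j).
Proof.
elim: n => [|n IH]; first by rewrite past1.
rewrite pastS; apply: measurableI => //.
by have [] := i_sampling (isT : (1 <= n.+1)%N) (j n.+1).
Qed.

Lemma past_probability n j : P (past i_ n.+1 j) = (\prod_(s < n) q (j s.+1))%:E.
Proof.
elim: n => [|n IH]; first by rewrite big_ord0 past1 probability_setT.
have [_ e ind] := i_sampling (isT : (1 <= n.+1)%N) (j n.+1).
by rewrite pastS ind IH e -EFinM big_ord_recr/= mulrC.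
Qed.

Context (K : nat).
Notation history := {ffun 'I_K.+1 -> 'I_N}.

(* [h o] is the index picked at iteration [o.+1]. *)
Definition history_path (h : history) (s : nat) : 'I_N := h (inord s.-1).

Definition history_event (h : history) : set T := past i_ K.+2 (history_path h).

Definition history_weight (h : history) : R := \prod_(o < K.+1) q (h o).

Lemma history_eventP h w :
  history_event h w <-> forall o : 'I_K.+1, i_ o.+1 w = h o.
Proof.
split=> [hw o|hw s /andP[]].
  rewrite (hw o.+1); first by rewrite /history_path/= inord_val.
  exact: (ltn_ord o).
case: s => // s _ sK.
  have sK' : (s < K.+1)%N by [].
  have := hw (Ordinal sK'); rewrite /= => ->.
by rewrite /history_path/=; congr (h _); apply: val_inj; rewrite /= inordK.
Qed.

Lemma history_event_measurable h : measurable (history_event h).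
Proof. exact: past_measurable. Qed.

Lemma history_event_probability h : P (history_event h) = (history_weight h)%:E.
Proof.
rewrite past_probability; congr (_%:E); apply: eq_bigr => o _.
by rewrite /history_path/= inord_val.
Qed.

Lemma history_event_partition w : exists h, forall h', history_event h' w <-> h' = h.
Proof.
exists [ffun o : 'I_K.+1 => i_ o.+1 w] => h'; rewrite history_eventP.
split=> [hw|-> o]; last by rewrite ffunE.
by apply/ffunP => o; rewrite ffunE hw.
Qed.

Lemma history_weight_gt0 h : 0 < history_weight h.
Proof. exact: prodr_gt0. Qed.

(** An empty event would have probability 0, whereas all weights are positive. The chosen points
    make it possible to compare runs whose histories differ in one index. *)
Lemma history_realized : exists w_ : history -> T, forall h, history_event h (w_ h).
Proof.
suff /choice[f fP] : forall h, exists w, history_event h w by exists f.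
move=> h; apply: contrapT => /forallNP h0.
have := history_event_probability h.
rewrite (_ : history_event h = set0); last by apply/seteqP; split.
by rewrite measure0 => -[] /esym/eqP; rewrite gt_eqF// history_weight_gt0.
Qed.

Definition resample (h : history) (o : 'I_K.+1) (k : 'I_N) : history :=
  [ffun s => if s == o then k else h s].

(* [(h, k) |-> (resample h o k, h o)] is a weight-preserving involution. *)
Lemma sum_resample (o : 'I_K.+1) (F : history -> R) :
  \sum_(h : history) history_weight h * F h =
  \sum_(h : history) history_weight h * \sum_(k < N) q k * F (resample h o k).
Proof.
pose f (a : history * 'I_N) := (resample a.1 o a.2, a.1 o).
have ff : involutive f.
  move=> [h k]; rewrite /f/=; congr pair; last by rewrite ffunE eqxx.
  by apply/ffunP => s; rewrite !ffunE; case: eqVneq => // ->.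
under [RHS]eq_bigr do rewrite mulr_sumr.
rewrite pair_bigA/=.
rewrite (reindex_inj (inv_inj ff))/=.
transitivity (\sum_(a : history * 'I_N) (history_weight a.1 * F a.1) * q a.2).
  rewrite -(pair_bigA _ (fun h k => (history_weight h * F h) * q k))/=.
  by apply: eq_bigr => h _; rewrite -mulr_sumr q_sum mulr1.
apply: eq_bigr => -[h k] _ /=.
have -> : resample (resample h o k) o (h o) = h by have [] := ff (h, k).
suff -> : history_weight (resample h o k) * (q (h o) * F h) =
  history_weight h * (q k * F h) by ring.
rewrite /history_weight (bigD1 o)//= [in RHS](bigD1 o)//= ffunE eqxx.
rewrite (eq_bigr (fun s => q (h s))); first by ring.
by move=> s /negbTE so; rewrite ffunE so.
Qed.

Lemma sum_history_weight : \sum_(h : history) history_weight h = 1.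
Proof.
rewrite /history_weight.
rewrite -(bigA_distr_bigA (fun (_ : 'I_K.+1) (k : 'I_N) => q k))/=.
by rewrite big1.
Qed.

Lemma integral_history (w_ : history -> T) (X : T -> R) :
  cellwise_constant history_event w_ X ->
  (\int[P]_w (X w)%:E = (\sum_h history_weight h * X (w_ h))%:E)%E.
Proof.
move=> cX; rewrite (integral_cellwise_constant P history_event_measurable
  history_event_partition cX).
congr (_%:E); apply: eq_bigr => h _.
by rewrite history_event_probability mulrC.
Qed.

(** The pairs (value of m, history) form a finite partition whose probabilities factor by
    independence. *)
Lemma integral_uniform_history (w_ : history -> T) (m : T -> nat) (X : nat -> T -> R) :
  uniform_index P K.+1 m -> independent_index P m i_ ->
  (forall k, (1 <= k <= K.+1)%N -> cellwise_constant history_event w_ (X k)) ->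
  (\int[P]_w (X (m w) w)%:E =
   (K.+1%:R^-1 * \sum_(1 <= k < K.+2) \sum_h history_weight h * X k (w_ h))%:E)%E.
Proof.
move=> [m1 mP] ind cX.
pose A (a : 'I_K.+1 * history) := [set w | m w = a.1.+1] `&` history_event a.2.
have Pm (k : 'I_K.+1) : measurable [set w | m w = k.+1] /\
    P [set w | m w = k.+1] = (K.+1%:R^-1)%:E by apply: mP; rewrite /= ltn_ord.
have PA a : P (A a) = (K.+1%:R^-1 * history_weight a.2)%:E.
  by rewrite EFinM -history_event_probability -(Pm a.1).2; exact: ind.
have /choice[v vP] : forall a, exists w, A a w.
  move=> a; apply: contrapT => /forallNP h0.
  have := PA a; rewrite (_ : A a = set0); last by apply/seteqP; split.
  rewrite measure0 => -[] /esym/eqP; rewrite gt_eqF//.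
  by rewrite mulr_gt0 ?history_weight_gt0// invr_gt0.
have Am a : measurable (A a).
  by apply: measurableI; [exact: (Pm a.1).1|exact: history_event_measurable].
have Apart w : exists a, forall b, A b w <-> b = a.
  have [h hP] := history_event_partition w; have /andP[m1w mK] := m1 w.
  have mlt : ((m w).-1 < K.+1)%N by rewrite prednK.
  exists (Ordinal mlt, h) => -[k h']; split=> [[/= e /hP ->]|[-> ->]].
    by congr pair; apply: val_inj; rewrite /= e.
  by split; [rewrite /= prednK|apply/hP].
have cY : cellwise_constant A v (fun w => X (m w) w).
  move=> a w [/= e hw]; have [/= e' hv] := vP a.
  have ka : (1 <= a.1.+1 <= K.+1)%N by rewrite /= ltn_ord.
  by rewrite e e' (cX _ ka _ _ hw) (cX _ ka _ _ hv).
rewrite (integral_cellwise_constant P Am Apart cY); congr (_%:E).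
(* The ordinal [a.1] stands for m = a.1 + 1, hence the shift. *)
rewrite (big_addn 0 K.+2 1) subn1/= big_mkord mulr_sumr.
under [RHS]eq_bigr do rewrite mulr_sumr.
rewrite pair_bigA/=; apply: eq_bigr => -[k h] _ /=.
have [/= e hv] := vP (k, h); rewrite e PA/= mulrC -mulrA addn1.
by rewrite (cX k.+1 _ _ _ hv)//= ltn_ord.
Qed.

End histories.

(** * The iterates *)

Section nestt.
Context {R : realType} {d N : nat}.
Notation V := 'rV[R]_d.
Context (Z : set V) (g : 'I_N -> V -> R) (g0 p : V -> R).
Context (M : R) (q : 'I_N -> R).
Context (N_gt0 : (0 < N)%N).
Context (M_gt0 : 0 < M).
Context (q_gt0 : forall k, 0 < q k).
Context (q_sum : \sum_(k < N) q k = 1).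
Context (g_smooth : forall i u, differentiable (g i) u).
Context (g0_smooth : forall u, differentiable g0 u).
Context (p_convex : convex_function setT p).
Context (p_lsc : real_lsc p).
Context (Z_closed : closed Z).
Context (Z_convex : convex_set Z).
Context (low : R).
Context (f_low : forall u, Z u -> low <= objective g g0 p u).
Context (g_lip : forall i, lipschitz_grad (g i) (N%:R * (M * q i ^+ 2))).
Context (g0_lip : lipschitz_grad g0 (\sum_(k < N) M * q k ^+ 2)).

Let sigma : R := \sum_(k < N) M * q k ^+ 2.
Let l (k : 'I_N) : R := M * q k ^+ 2.

Let sigmaM : sigma <= M. Proof. exact: curvature_le. Qed.

Definition sgrad (i : 'I_N) (u : V) : V := N%:R^-1 *: grad (g i) u.

Let N0 : N%:R != 0 :> R. Proof. by rewrite pnatr_eq0 -lt0n. Qed.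

Lemma sgrad_lipschitz i u v : enorm (sgrad i u - sgrad i v) <= l i * enorm (u - v).
Proof.
rewrite -scalerBr enormZ ger0_norm ?invr_ge0//.
by rewrite ler_pdivrMl ?ltr0n// mulrA; exact: g_lip.
Qed.

Lemma gmean_smooth u : differentiable (gmean g) u.
Proof.
rewrite (_ : gmean g = N%:R^-1 *: (\sum_(i < N) g i)).
  by apply: differentiableZ; apply: differentiable_sum.
by apply/funext => w; rewrite -[RHS]/(N%:R^-1 * (\sum_(i < N) g i) w) fct_sumE.
Qed.

Lemma grad_gmean u : grad (gmean g) u = \sum_(i < N) sgrad i u.
Proof.
rewrite /gmean gradZ; last first.
  rewrite (_ : (fun w => _) = \sum_(i < N) g i); first exact: differentiable_sum.
  by apply/funext => w; rewrite fct_sumE.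
by rewrite grad_sum// scaler_sumr.
Qed.

Lemma gmean_lipschitz : lipschitz_grad (gmean g) sigma.
Proof.
move=> u v; rewrite !grad_gmean -sumrB mulr_suml.
by apply: le_trans (enorm_sum _ _) _; apply: ler_sum => i _; exact: sgrad_lipschitz.
Qed.

Definition smooth_grad (u : V) : V := grad (fun w => gmean g w + g0 w) u.

Lemma smooth_gradE u : smooth_grad u = grad (gmean g) u + grad g0 u.
Proof. by rewrite /smooth_grad gradD//; exact: gmean_smooth. Qed.

Lemma smooth_grad_lipschitz u v :
  enorm (smooth_grad u - smooth_grad v) <= (sigma + sigma) * enorm (u - v).
Proof.
rewrite !smooth_gradE opprD addrACA mulrDl.
by apply: le_trans (enormD _ _) _; apply: lerD; [exact: gmean_lipschitz|exact: g0_lip].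
Qed.

(** Write p = f - g - g0 and bound g and g0 above by their quadratic models at v. This costs sigma
    |u - v|^2, and Young's inequality on the linear term costs M/2 |u - v|^2; 3M/2 covers both since
    sigma <= M. *)
Lemma prox_objective_below v : exists b, forall u, Z u ->
  b <= p u + 3 * M / 2 * dot (u - v) (u - v).
Proof.
exists (low - gmean g v - g0 v - (2 * M)^-1 * dot (smooth_grad v) (smooth_grad v)).
move=> u Zu; have := f_low Zu; rewrite /objective.
have := lipschitz_grad_le v u gmean_smooth gmean_lipschitz.
have := lipschitz_grad_le v u g0_smooth g0_lip; rewrite -/sigma.
have := dot_young (smooth_grad v) (u - v) (ltac:(rewrite invr_gt0; exact: M_gt0) : 0 < M^-1).
rewrite invrK invfM {1}smooth_gradE dotDl.
have := ler_wpM2r (dot_ge0 (u - v)) sigmaM; lra.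
Qed.

Context (Z_nonempty : Z !=set0).

Notation ppoint := (prox_point Z p (3 * M) smooth_grad).

Let M3 : 0 < 3 * M. Proof. by rewrite mulr_gt0. Qed.

(** The weight 3M outweighs the possible concavity -sigma of g0, leaving a modulus of at least
    2M. *)
Let objective_strongly_convex z v :
  strongly_convex Z (fun u => p u + (g0 u + (dot v (u - z)
    + 3 * M / 2 * dot (u - z) (u - z)))) (0 + (- sigma + 3 * M)).
Proof.
apply: strongly_convexD; first exact: convex_strongly_convex.
apply: strongly_convexD; first exact: lipschitz_grad_strongly_convex.
exact: affine_strongly_convex.
Qed.

Let ppoint_in z : Z (ppoint z).
Proof.
exact: (prox_point_in Z_closed Z_convex Z_nonempty p_convex p_lsc M3
  prox_objective_below).
Qed.

Let ppoint_strong z u (Zu : Z u) :=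
  prox_point_strong Z_closed Z_convex Z_nonempty p_convex p_lsc M3
    prox_objective_below smooth_grad z Zu.

Lemma gapE z : gap Z g g0 p (3 * M)^-1 z =
  9 * M ^+ 2 * dot (ppoint z - z) (ppoint z - z).
Proof.
rewrite /gap /prox_grad invrK -/(smooth_grad z) -/(ppoint z).
rewrite sqr_enorm !dotE (dotC z); ring.
Qed.

Lemma gap_continuous : continuous (gap Z g g0 p (3 * M)^-1).
Proof.
have c1 : continuous ppoint.
  apply: (prox_point_continuous Z_closed Z_convex Z_nonempty p_convex p_lsc M3).
    exact: prox_objective_below.
  exact: smooth_grad_lipschitz.
move=> z; rewrite (_ : gap _ _ _ _ _ =
  fun z => 9 * M ^+ 2 * dot (ppoint z - z) (ppoint z - z)).
  have cB : {for z, continuous (fun w : V => ppoint w - w)}.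
    by apply: (@continuousB _ _ _ ppoint id); [exact: c1|exact: cvg_id].
  have cc : {for z, continuous (fun=> 9 * M ^+ 2 : R)}.
    exact: (@cvg_cst _ _ _ _ (nbhs_filter z)).
  exact: (continuousM cc (dot_continuous cB cB)).
by apply/funext => w; exact: gapE.
Qed.

Lemma hfunE u : Z u -> hfun Z p u = (p u)%:E.
Proof. by move=> Zu; rewrite /hfun /indicator mem_set// add0e. Qed.

(** A zero gap makes z a fixed point of the proximal step; in the growth inequality the two
    quadratic terms in v - z then cancel, and the subgradient inequality remains. *)
Lemma gap0_subdifferential z : gap Z g g0 p (3 * M)^-1 z = 0 ->
  subdifferential (hfun Z p) z (- smooth_grad z).
Proof.
move=> /eqP; rewrite gapE mulf_eq0 gt_eqF ?mulr_gt0 ?exprn_gt0//= => /eqP/dot_eq0/eqP.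
rewrite subr_eq0 => /eqP zE v.
have Zz : Z z by rewrite -zE.
rewrite (hfunE Zz); have [Zv|nZv] := pselect (Z v); last first.
  by rewrite /hfun/indicator memNset// addye// leey.
have := ppoint_strong z Zv.
by rewrite zE subrr !dot0r (hfunE Zv) lee_fin dotNl; lra.
Qed.

(** Sum of four inequalities: growth of the proximal problem tested at z, growth of the z-subproblem
    tested at the proximal point, and the quadratic upper bounds of g at z' and of g0 at the
    proximal point. *)
Lemma estimator_descent z z' v : Z z ->
  argmin (fun u => p u + (g0 u + (dot v (u - z) + 3 * M / 2 * dot (u - z) (u - z)))) Z z' ->
  objective g g0 p z' <= objective g g0 p z
  - (3 * M - sigma) / 2 * (dot (ppoint z - z) (ppoint z - z)
      + dot (z' - ppoint z) (z' - ppoint z) + dot (z' - z) (z' - z))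
  + dot (grad (gmean g) z - v) (z' - ppoint z).
Proof.
move=> Zz az'; have h1 := ppoint_strong z Zz.
have h2 := argmin_strong Z_convex (@objective_strongly_convex z v) az' (ppoint_in z).
have h3 := lipschitz_grad_le z z' gmean_smooth gmean_lipschitz.
have h4 := lipschitz_grad_le z (ppoint z) g0_smooth g0_lip.
rewrite /objective; move: h1 h2 h3 h4; rewrite -/sigma smooth_gradE.
move: (ppoint z) (grad (gmean g) z) (grad g0 z) => h a b.
rewrite !dotE ?(dotC z h) ?(dotC z z') ?(dotC z' h); lra.
Qed.

Context (z1 : V) (y0 : 'I_N -> V).
Let eta (k : 'I_N) : R := 3 * M * q k.

(** These are the D_j; the index [r.-1] appears because iteration r starts from the memory points
    y^{r-1}. *)
Definition stale (i_ : nat -> 'I_N) (z : nat -> V) (r : nat) (j : 'I_N) : V :=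
  sgrad j (memory y0 i_ z r.-1 j) - sgrad j (z r).

(** * Structure of a single run *)

Section one_run.
Context (i_ : nat -> 'I_N) (x : nat -> 'M[R]_(N, d)) (z : nat -> V)
  (lam : nat -> 'M[R]_(N, d)).
Context (run : nestt_g Z g g0 p q eta z1 y0 i_ x z lam).

Lemma picked_update r : (1 <= r)%N ->
  (q (i_ r) * eta (i_ r)) *: (row (i_ r) (x r.+1) - z r) =
  - (sgrad (i_ r) (z r) + row (i_ r) (lam r)).
Proof.
move=> r1; apply: (@quadratic_argmin _ _ _ _ _ (N%:R^-1 * g (i_ r) (z r))).
  by rewrite /eta !mulr_gt0.
have := nestt_x_picked run r1; congr (argmin _ _ _); apply/funext => w.
by rewrite /block_model sqr_enorm [in RHS](dotDl (sgrad _ _)) /sgrad dotZl !addrA.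
Qed.

(** Optimality of the x-step makes the dual update cancel the old multiplier and store minus the
    gradient at the current z. *)
Lemma multiplier_memory r j : (1 <= r)%N ->
  row j (lam r) = - sgrad j (memory y0 i_ z r.-1 j).
Proof.
case: r => // r _; elim: r => [|r IH]; first by rewrite (nestt_lam1 run).
rewrite [memory _ _ _ _]/=; have [->|ne] := eqVneq j (i_ r.+1).
  rewrite (nestt_lam_picked run (isT : (1 <= r.+1)%N)).
  by rewrite (picked_update (isT : (1 <= r.+1)%N)) opprD addrCA subrr addr0.
by rewrite (nestt_lam_other run (isT : (1 <= r.+1)%N) ne).
Qed.

Lemma picked_displacement r : (1 <= r)%N ->
  (q (i_ r) * eta (i_ r)) *: (row (i_ r) (x r.+1) - z r) = stale i_ z r (i_ r).
Proof.
by move=> r1; rewrite picked_update// multiplier_memory// opprD opprK addrC.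
Qed.

Lemma iterate_in r : Z z1 -> (1 <= r)%N -> Z (z r).
Proof.
move=> Z1; case: r => [//|[_|r _]]; first by rewrite (nestt_z1 run).
exact: (proj1 (nestt_z run (r := r.+1) _)).
Qed.

Lemma stale_next r : (1 <= r)%N ->
  stale i_ z r.+1 = refreshed (stale i_ z r)
    (fun _ j => sgrad j (z r) - sgrad j (z r.+1)) (i_ r).
Proof.
case: r => // r _; apply/funext => j; rewrite /stale /refreshed [memory _ _ _ _]/=.
by have [->|ne] := eqVneq j (i_ r.+1); rewrite ?eqxx ?(negbTE ne)//= addrA subrK.
Qed.

(** This equals the sum of the stored gradients at the y_j minus D_k / q_k, a SAGA estimator with
    nonuniform sampling. *)
Definition estimator r : V := grad (gmean g) (z r)
  - ((q (i_ r))^-1 *: stale i_ z r (i_ r) - \sum_(j < N) stale i_ z r j).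

(** The augmented Lagrangian is expanded around z^r: the eta_i add up to 3M, and only the picked
    block has x_i different from z^r. *)
Lemma iterate_argmin r : (1 <= r)%N ->
  argmin (fun u => p u + (g0 u + (dot (estimator r) (u - z r)
    + 3 * M / 2 * dot (u - z r) (u - z r)))) Z (z r.+1).
Proof.
move=> r1; have [Zr h] := nestt_z run r1; split=> // u Zu.
pose x' i := row i (x r.+1).
pose c0 := \sum_(i < N) (N%:R^-1 * g i (x' i) + dot (row i (lam r)) (x' i - z r)
   + eta i / 2 * dot (x' i - z r) (x' i - z r)).
have key w : \sum_(i < N) (N%:R^-1 * g i (x' i) + dot (row i (lam r)) (x' i - w)
   + eta i / 2 * enorm (x' i - w) ^+ 2) =
   c0 + dot (estimator r) (w - z r) + 3 * M / 2 * dot (w - z r) (w - z r).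
  transitivity (c0 + \sum_(i < N) dot (- row i (lam r) - eta i *: (x' i - z r)) (w - z r)
    + (\sum_(i < N) eta i) / 2 * dot (w - z r) (w - z r)).
    rewrite mulr_suml mulr_suml -!big_split/=; apply: eq_bigr => i _.
    rewrite sqr_enorm (_ : x' i - w = (x' i - z r) - (w - z r)); last first.
      by rewrite opprB addrA subrK.
    move: (x' i - z r) (w - z r) => a b; rewrite !dotE (dotC b a).
    by field.
  rewrite -dot_suml -mulr_sumr q_sum mulr1; congr (_ + dot _ _ + _).
  rewrite sumrB (bigD1 (i_ r) (F := fun i => eta i *: _))//=.
  rewrite [X in _ - (_ + X)]big1 ?addr0; last first.
    by move=> j ne; rewrite /x' (nestt_x_other run)// subrr scaler0.
  rewrite /estimator opprB addrA; congr (_ + _).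
    rewrite grad_gmean -big_split/=; apply: eq_bigr => j _.
    by rewrite multiplier_memory// opprK /stale subrKC.
  (* Since alpha_k = q_k, the term eta_k (x_k - z) is D_k / q_k. *)
  congr (- _); rewrite -picked_displacement// scalerA mulKf// gt_eqF//.
move: (h u Zu); rewrite /aug_lagrangian !hfunE// -!EFinD lee_fin.
by rewrite !(key _ : \sum_(i < N) _ = _); lra.
Qed.

Definition potential_real r : R := objective g g0 p (z r)
  + \sum_(j < N) dot (stale i_ z r j) (stale i_ z r j) / l j.

(** With alpha = prob = q and eta = 3 M q, the coefficient 3 q eta / (q eta)^2 is 1 / (M q^2). *)
Lemma potentialE r : Z z1 -> (1 <= r)%N ->
  potential Z g g0 p q eta q y0 i_ z r = (potential_real r)%:E.
Proof.
move=> Z1 r1; rewrite /potential (hfunE (iterate_in Z1 r1)) -EFinD; congr (_%:E).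
rewrite /potential_real /objective /gmean mulr_sumr.
suff -> : \sum_(i < N) 3 * q i * eta i / (q i * eta i) ^+ 2 *
  enorm (N%:R^-1 *: (grad (g i) (memory y0 i_ z r.-1 i) - grad (g i) (z r))) ^+ 2 =
  \sum_(j < N) dot (stale i_ z r j) (stale i_ z r j) / l j by lra.
apply: eq_bigr => j _; rewrite sqr_enorm scalerBr -/(stale i_ z r j) /eta /l.
by field; rewrite !gt_eqF.
Qed.

Lemma potential_ge r : Z z1 -> (1 <= r)%N -> low <= potential_real r.
Proof.
move=> Z1 r1; apply: le_trans (f_low (iterate_in Z1 r1)) _; rewrite lerDl.
by apply: sumr_ge0 => j _; rewrite divr_ge0 ?dot_ge0// /l mulr_ge0 ?exprn_ge0 ?ltW.
Qed.

Definition primal_residual r : R :=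
  \sum_(i < N) 3 * eta i ^+ 2 * enorm (row i (x r.+1) - z r) ^+ 2.

Lemma primal_residualE r : (1 <= r)%N ->
  primal_residual r = 3 * dot (stale i_ z r (i_ r)) (stale i_ z r (i_ r)) / q (i_ r) ^+ 2.
Proof.
move=> r1; rewrite /primal_residual (bigD1 (i_ r))//= big1 ?addr0; last first.
  by move=> j ne; rewrite (nestt_x_other run)// subrr enorm0 expr0n mulr0.
rewrite -picked_displacement// sqr_enorm dotZl dotZr /eta; field.
by rewrite gt_eqF.
Qed.

(** The last two terms are there for the limit points: they force the steps of z and all stale
    differences, not only those of the picked blocks, to vanish. *)
Definition progress r : R := gap Z g g0 p (3 * M)^-1 (z r) + primal_residual r
  + M ^+ 2 * dot (z r.+1 - z r) (z r.+1 - z r) + M / 5 * spread M q (stale i_ z r).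

Lemma iterate_descent r : Z z1 -> (1 <= r)%N ->
  objective g g0 p (z r.+1) <= objective g g0 p (z r)
  - (3 * M - sigma) / 2 * (dot (ppoint (z r) - z r) (ppoint (z r) - z r)
      + dot (z r.+1 - ppoint (z r)) (z r.+1 - ppoint (z r))
      + dot (z r.+1 - z r) (z r.+1 - z r))
  + dot ((q (i_ r))^-1 *: stale i_ z r (i_ r) - \sum_(j < N) stale i_ z r j)
        (z r.+1 - ppoint (z r)).
Proof.
move=> Z1 r1; have := estimator_descent (iterate_in Z1 r1) (iterate_argmin r1).
by rewrite /estimator subKr.
Qed.

End one_run.

(** Run k picks block k at iteration r, and all runs share z^r and the stale differences; the
    weighted sum over k plays the role of the expectation conditional on the past. *)
Lemma expected_progress (i_ : 'I_N -> nat -> 'I_N) (x : 'I_N -> nat -> 'M[R]_(N, d))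
    (z : 'I_N -> nat -> V) (lam : 'I_N -> nat -> 'M[R]_(N, d)) (r : nat)
    (zr : V) (D : 'I_N -> V) :
  (forall k, nestt_g Z g g0 p q eta z1 y0 (i_ k) (x k) (z k) (lam k)) ->
  Z z1 -> (1 <= r)%N ->
  (forall k, [/\ i_ k r = k, z k r = zr & stale (i_ k) (z k) r = D]) ->
  \sum_(k < N) q k * progress (i_ k) (x k) (z k) r <=
  80 / 3 * M * \sum_(k < N) q k *
    (potential_real (i_ k) (z k) r - potential_real (i_ k) (z k) r.+1).
Proof.
move=> run Z1 r1 same.
have C_le k j : dot (sgrad j zr - sgrad j (z k r.+1)) (sgrad j zr - sgrad j (z k r.+1))
    <= l j ^+ 2 * dot (z k r.+1 - zr) (z k r.+1 - zr).
  have l0 : 0 <= l j by rewrite mulr_ge0 ?exprn_ge0// ltW.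
  rewrite -!sqr_enorm -exprMn ler_sqr ?nnegrE ?enorm_ge0 ?(mulr_ge0 l0 (enorm_ge0 _))//.
  by rewrite -(enormN (_ - zr)) opprB; exact: sgrad_lipschitz.
have H := @expected_decrease _ _ _ _ _ M_gt0 q_gt0 q_sum D
  (fun k j => sgrad j zr - sgrad j (z k r.+1)) (objective g g0 p zr)
  (fun k => objective g g0 p (z k r.+1)) (ppoint zr - zr)
  (fun k => z k r.+1 - ppoint zr) (fun k => z k r.+1 - zr).
rewrite (_ : \sum_(k < N) q k * progress _ _ _ _ = \sum_(k < N) q k *
  (9 * M ^+ 2 * dot (ppoint zr - zr) (ppoint zr - zr)
    + 3 * dot (D k) (D k) / q k ^+ 2
    + M ^+ 2 * dot (z k r.+1 - zr) (z k r.+1 - zr) + M / 5 * spread M q D)); last first.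
  apply: eq_bigr => k _; have [ik zk Dk] := same k.
  by rewrite /progress (primal_residualE (run k))// gapE zk Dk ik.
apply: le_trans (H _ C_le _) _.
- by move=> k; rewrite [RHS]addrC addrA subrK.
- move=> k; have [ik zk Dk] := same k.
  by have := iterate_descent (run k) Z1 r1; rewrite zk Dk ik.
rewrite le_eqVlt; apply/orP; left; apply/eqP; congr (_ * _).
apply: eq_bigr => k _; have [ik zk Dk] := same k.
by rewrite /potential_real (stale_next (i_ k) (z k) r1) zk Dk ik /refreshed.
Qed.

(** z^r, the stale differences and the picked index determine the z-subproblem, whose minimizer is
    unique by strong convexity; so z^r is a function of the earlier indices. The induction carries
    the memory points along. *)
Lemma runs_agree (i_ i_' : nat -> 'I_N) (x x' : nat -> 'M[R]_(N, d))
    (z z' : nat -> V) (lam lam' : nat -> 'M[R]_(N, d)) (n : nat) :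
  nestt_g Z g g0 p q eta z1 y0 i_ x z lam ->
  nestt_g Z g g0 p q eta z1 y0 i_' x' z' lam' ->
  (forall s, (1 <= s < n)%N -> i_ s = i_' s) ->
  forall r, (1 <= r <= n)%N -> z r = z' r /\ stale i_ z r = stale i_' z' r.
Proof.
move=> run run' ii r rn.
suff [zz mm] : z r = z' r /\ memory y0 i_ z r.-1 = memory y0 i_' z' r.-1.
  by split; [exact: zz|apply/funext => j; rewrite /stale mm zz].
elim: r rn => // -[_ _|r IH /andP[_ rn]].
  by rewrite (nestt_z1 run) (nestt_z1 run').
have /IH[zz mm] : (1 <= r.+1 <= n)%N by rewrite /= ltnW.
have ir : i_ r.+1 = i_' r.+1 by apply: ii; rewrite /= rn.
have ss : stale i_ z r.+1 = stale i_' z' r.+1.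
  by apply/funext => j; rewrite /stale mm zz.
split; last first.
  rewrite /= in mm; apply/funext => j; rewrite /= ir zz.
  by case: ifP => [_|_]; [|rewrite mm].
have := iterate_argmin run' (isT : (1 <= r.+1)%N).
have := iterate_argmin run (isT : (1 <= r.+1)%N).
rewrite /estimator ss zz ir => a a'.
apply: (argmin_uniq Z_convex (@objective_strongly_convex _ _)) a a'.
by have := sigmaM; have := M_gt0; lra.
Qed.

Lemma progress_agree (i_ i_' : nat -> 'I_N) (x x' : nat -> 'M[R]_(N, d))
    (z z' : nat -> V) (lam lam' : nat -> 'M[R]_(N, d)) (r : nat) :
  nestt_g Z g g0 p q eta z1 y0 i_ x z lam ->
  nestt_g Z g g0 p q eta z1 y0 i_' x' z' lam' ->
  (1 <= r)%N -> (forall s, (1 <= s <= r)%N -> i_ s = i_' s) ->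
  [/\ gap Z g g0 p (3 * M)^-1 (z r) = gap Z g g0 p (3 * M)^-1 (z' r),
      primal_residual x z r = primal_residual x' z' r,
      progress i_ x z r = progress i_' x' z' r,
      potential_real i_ z r = potential_real i_' z' r &
      potential_real i_ z r.+1 = potential_real i_' z' r.+1].
Proof.
move=> run run' r1 ii.
have agree := runs_agree (n := r.+1) run run' ii.
have [zz ss] := agree r (ltac:(by rewrite r1 leqnSn)).
have [zz1 ss1] := agree r.+1 (ltac:(by rewrite leqnn)).
have pp : primal_residual x z r = primal_residual x' z' r.
  have ir : i_ r = i_' r by apply: ii; rewrite r1 leqnn.
  by rewrite (primal_residualE run r1) (primal_residualE run' r1) ss ir.
split; first by rewrite zz.
- exact: pp.
- by rewrite /progress pp zz ss zz1.
- by rewrite /potential_real zz ss.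
- by rewrite /potential_real zz1 ss1.
Qed.

(** * Limit points of a run *)

Section cluster_points.
Context (i_ : nat -> 'I_N) (x : nat -> 'M[R]_(N, d)) (z : nat -> V)
  (lam : nat -> 'M[R]_(N, d)).

Lemma primal_residual_ge0 r : 0 <= primal_residual x z r.
Proof.
by apply: sumr_ge0 => k _; rewrite mulr_ge0 ?sqr_ge0// mulr_ge0// sqr_ge0.
Qed.

Lemma gap_residual_le_progress r :
  gap Z g g0 p (3 * M)^-1 (z r) + primal_residual x z r <= progress i_ x z r.
Proof.
rewrite /progress -addrA lerDl addr_ge0// mulr_ge0 ?dot_ge0 ?sqr_ge0//.
  by rewrite divr_ge0// ltW.
exact: spread_ge0.
Qed.

Lemma gap_ge0 u : 0 <= gap Z g g0 p (3 * M)^-1 u.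
Proof. exact: sqr_ge0. Qed.

Lemma progress_ge0 r : 0 <= progress i_ x z r.
Proof.
apply: le_trans (gap_residual_le_progress _).
by rewrite addr_ge0 ?gap_ge0 ?primal_residual_ge0.
Qed.

Lemma stale_le_progress r j :
  dot (stale i_ z r j) (stale i_ z r j) <= 5 * progress i_ x z r.
Proof.
have h : dot (stale i_ z r j) (stale i_ z r j) <= M * spread M q (stale i_ z r).
  rewrite /spread mulr_sumr (bigD1 j)//=.
  have q0 := q_gt0 j; have q1 : q j <= 1.
    by rewrite -q_sum (bigD1 j)//= lerDl; apply: sumr_ge0 => k _; rewrite ltW.
  apply: (@le_trans _ _ (M * (dot (stale i_ z r j) (stale i_ z r j) / (M * q j)))).
    rewrite mulrA ler_pdivlMr ?mulr_gt0// mulrCA ler_pM2l//.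
    by rewrite ler_piMr ?dot_ge0.
  rewrite lerDl; apply: sumr_ge0 => k _.
  by rewrite mulr_ge0 ?divr_ge0 ?dot_ge0 ?mulr_ge0 ?ltW.
have := gap_ge0 (z r); have := primal_residual_ge0 r.
have := mulr_ge0 (sqr_ge0 M) (dot_ge0 (z r.+1 - z r)).
by rewrite /progress; lra.
Qed.

Lemma step_le_progress r :
  dot (z r.+1 - z r) (z r.+1 - z r) <= (M ^+ 2)^-1 * progress i_ x z r.
Proof.
have M2 : 0 < M ^+ 2 by rewrite exprn_gt0.
rewrite -(ler_pM2l M2) mulVKf ?gt_eqF//.
have := gap_ge0 (z r); have := primal_residual_ge0 r.
have := mulr_ge0 (ltW M_gt0) (spread_ge0 M_gt0 q_gt0 (stale i_ z r)).
by rewrite /progress; lra.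
Qed.

Lemma displacement_le_progress r j :
  dot (row j (x r.+1) - z r) (row j (x r.+1) - z r) <=
  (3 * eta j ^+ 2)^-1 * progress i_ x z r.
Proof.
have e2 : 0 < 3 * eta j ^+ 2 by rewrite mulr_gt0// exprn_gt0// /eta !mulr_gt0.
rewrite -(ler_pM2l e2) mulVKf ?gt_eqF//.
apply: le_trans (gap_residual_le_progress r); apply: (@le_trans _ _ (primal_residual x z r)).
  rewrite /primal_residual (bigD1 j)//= sqr_enorm lerDl; apply: sumr_ge0 => k _.
  by rewrite mulr_ge0 ?sqr_ge0// mulr_ge0// sqr_ge0.
by rewrite lerDr gap_ge0.
Qed.

Context (run : nestt_g Z g g0 p q eta z1 y0 i_ x z lam).
Context (progress0 : progress i_ x z r.+1 @[r --> \oo] --> 0).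

Lemma vanish_of_le (f : nat -> R) (c : R) : (forall r, 0 <= f r) ->
  (forall r, f r.+1 <= c * progress i_ x z r.+1) -> f r @[r --> \oo] --> 0.
Proof.
move=> f0 fp; rewrite -cvg_shiftS.
apply: (@squeeze_cvgr _ _ _ _ (fun=> 0) (fun r => c * progress i_ x z r.+1)).
- by apply: nearW => r; rewrite f0 fp.
- exact: cvg_cst.
- by rewrite -[X in _ --> X](mulr0 c); apply: cvgMr; exact: progress0.
Qed.

Lemma cluster_stationary xs zs lams :
  cluster ((fun r => (x r, z r, lam r)) @ \oo) (xs, zs, lams) ->
  stationary Z g g0 p xs zs lams.
Proof.
move=> cl; pose U := ('M[R]_(N, d) * V * 'M[R]_(N, d))%type.
have cz : {for (xs, zs, lams) : U, continuous (fun a : U => a.1.2)}.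
  by apply: (@continuous_comp _ _ _ fst snd); [exact: cvg_fst|exact: cvg_snd].
have cx i : {for (xs, zs, lams) : U, continuous (fun a : U => row i a.1.1)}.
  apply: (@continuous_comp _ _ _ (fst \o fst) (row i)).
    by apply: (@continuous_comp _ _ _ fst fst); exact: cvg_fst.
  exact: row_continuous.
have clam i : {for (xs, zs, lams) : U, continuous (fun a : U => row i a.2)}.
  by apply: (@continuous_comp _ _ _ snd (row i)); [exact: cvg_snd|exact: row_continuous].
have gap0 : gap Z g g0 p (3 * M)^-1 zs = 0.
  apply: (cluster_limit (f := fun a : U => gap Z g g0 p (3 * M)^-1 a.1.2) cl).
    by apply: (continuous_comp cz); exact: gap_continuous.
  apply: (@vanish_of_le _ 1) => r; first exact: gap_ge0.
  rewrite mul1r; apply: le_trans (gap_residual_le_progress _).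
  by rewrite lerDl primal_residual_ge0.
pose f1 i (a : U) : R := dot (row i a.1.1 - a.1.2) (row i a.1.1 - a.1.2).
have f10 i : f1 i (xs, zs, lams) = 0.
  apply: (cluster_limit cl).
    by apply: dot_continuous; exact: (continuousB (cx i) cz).
  (* [x 1] is arbitrary, so one more shift is made; x^{r+2} is then compared with z^{r+2} through
     z^{r+1}, using |a - b|^2 <= 2 |a|^2 + 2 |b|^2. *)
  rewrite -cvg_shiftS.
  apply: (@vanish_of_le _ (2 * (3 * eta i ^+ 2)^-1 + 2 * (M ^+ 2)^-1)) => r.
    exact: dot_ge0.
  have := displacement_le_progress r.+1 i; have := step_le_progress r.+1.
  have := dot_ge0 ((row i (x r.+2) - z r.+1) + (z r.+2 - z r.+1)).
  have -> : f1 i (x r.+2, z r.+2, lam r.+2) =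
    dot ((row i (x r.+2) - z r.+1) - (z r.+2 - z r.+1))
        ((row i (x r.+2) - z r.+1) - (z r.+2 - z r.+1)).
    by rewrite opprB addrA subrK.
  move: (row i (x r.+2) - _) (z r.+2 - _) => a b.
  move: ((3 * _)^-1) ((M ^+ 2)^-1) => c1 c2; rewrite !dotE (dotC b a); lra.
pose f2 i (a : U) : R := dot (sgrad i a.1.2 + row i a.2) (sgrad i a.1.2 + row i a.2).
have f20 i : f2 i (xs, zs, lams) = 0.
  apply: (cluster_limit cl).
    have cs : {for (xs, zs, lams) : U, continuous (fun a : U => sgrad i a.1.2)}.
      apply: (continuous_comp cz).
      exact: (enorm_lipschitz_continuous (sgrad_lipschitz i)).
    by apply: dot_continuous; exact: (continuousD cs (clam i)).
  apply: (@vanish_of_le _ 5) => r; first exact: dot_ge0.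
  rewrite /f2/= (multiplier_memory run)//.
  by rewrite -opprB dotNl dotNr opprK; exact: stale_le_progress.
have xz i : row i xs = zs by apply/eqP; rewrite -subr_eq0; apply/eqP/dot_eq0/f10.
have lg i : sgrad i zs + row i lams = 0 by apply/dot_eq0/f20.
split=> [i|]; first by rewrite xz; split=> //; exact: lg.
(* The limit multipliers are minus the block gradients, so this subgradient balances the last
   stationarity condition. *)
exists (- smooth_grad zs); first exact: gap0_subdifferential.
rewrite smooth_gradE grad_gmean (eq_bigr (fun i => - sgrad i zs)); last first.
  by move=> i _; apply/eqP; rewrite -addr_eq0 addrC lg.
by rewrite sumrN opprK [X in _ - X]addrC subrr.
Qed.

End cluster_points.

(** * Expected bounds and almost sure convergence *)

Section random_run.
Context {disp : measure_display} {T : measurableType disp} (P : probability T R).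
Context (i_ : nat -> T -> 'I_N) (x : nat -> T -> 'M[R]_(N, d))
  (z : nat -> T -> V) (lam : nat -> T -> 'M[R]_(N, d)).
Context (i_sampling : sampling P q i_).
Context (run : forall w,
  nestt_g Z g g0 p q eta z1 y0 (i_ ^~ w) (x ^~ w) (z ^~ w) (lam ^~ w)).
Context (Z1 : Z z1).

Let gap_at (r : nat) (w : T) : R := gap Z g g0 p (3 * M)^-1 (z r w).
Let residual_at (r : nat) (w : T) : R := primal_residual (x ^~ w) (z ^~ w) r.
Let progress_at (r : nat) (w : T) : R := progress (i_ ^~ w) (x ^~ w) (z ^~ w) r.
Let potential_at (r : nat) (w : T) : R := potential_real (i_ ^~ w) (z ^~ w) r.

Section fixed_horizon.
Context (K : nat) (w_ : {ffun 'I_K.+1 -> 'I_N} -> T).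
Context (w_in : forall h, history_event i_ h (w_ h)).

Lemma history_cellwise_constant r : (1 <= r <= K.+1)%N ->
  [/\ cellwise_constant (history_event i_ (K := K)) w_ (gap_at r),
      cellwise_constant (history_event i_ (K := K)) w_ (residual_at r),
      cellwise_constant (history_event i_ (K := K)) w_ (progress_at r),
      cellwise_constant (history_event i_ (K := K)) w_ (potential_at r) &
      cellwise_constant (history_event i_ (K := K)) w_ (potential_at r.+1)].
Proof.
move=> /andP[r1 rK].
have agree h w : history_event i_ h w -> [/\ gap_at r w = gap_at r (w_ h),
    residual_at r w = residual_at r (w_ h), progress_at r w = progress_at r (w_ h),
    potential_at r w = potential_at r (w_ h) &
    potential_at r.+1 w = potential_at r.+1 (w_ h)].
  move=> hw; apply: (progress_agree (run w) (run (w_ h)) r1) => s /andP[s1 sr].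
  have sK : (1 <= s < K.+2)%N by rewrite s1 ltnS (leq_trans sr).
  by rewrite (hw _ sK) (w_in h sK).
by split=> h w /agree[].
Qed.

(** [sum_resample] averages first over the index of iteration r with the others fixed. The resampled
    histories agree before r, so [expected_progress] applies to each such family. *)
Lemma sum_progress_step r : (1 <= r <= K.+1)%N ->
  \sum_h history_weight q h * progress_at r (w_ h) <= 80 / 3 * M *
  \sum_h history_weight q h * (potential_at r (w_ h) - potential_at r.+1 (w_ h)).
Proof.
move=> /andP[r1 rK]; pose o : 'I_K.+1 := inord r.-1.
have oE : o.+1 = r by rewrite /o inordK prednK.
rewrite [leLHS](sum_resample q_sum o) [in leRHS](sum_resample q_sum o) mulr_sumr.
apply: ler_sum => h _.
rewrite mulrCA ler_pM2l ?history_weight_gt0//.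
have path_other k s : (1 <= s < r)%N ->
    i_ s (w_ (resample h o k)) = i_ s (w_ h).
  move=> /andP[s1 sr]; have sK : (1 <= s < K.+2)%N.
    by rewrite s1 ltnS (leq_trans (ltnW sr)).
  rewrite (w_in _ sK) (w_in _ sK) /history_path ffunE; case: eqVneq => // so.
  move: sr; rewrite -oE -so inordK ?prednK ?ltnn//.
  by case: s s1 sK {so} => // s _ /andP[].
apply: (expected_progress (zr := z r (w_ h)) (D := stale (i_ ^~ (w_ h)) (z ^~ (w_ h)) r)
  (fun k => run (w_ (resample h o k))) Z1 r1) => k.
have [zE sE] := runs_agree (run (w_ (resample h o k))) (run (w_ h)) (path_other k)
  (ltac:(by rewrite r1 leqnn) : (1 <= r <= r)%N).
have rK2 : (1 <= r < K.+2)%N by rewrite r1 ltnS.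
by split; [rewrite (w_in _ rK2) /history_path ffunE eqxx|exact: zE|exact: sE].
Qed.

Lemma sum_progress :
  \sum_(1 <= r < K.+2) \sum_h history_weight q h * progress_at r (w_ h) <=
  80 / 3 * M * \sum_h history_weight q h * (potential_at 1 (w_ h) - potential_at K.+2 (w_ h)).
Proof.
apply: (@le_trans _ _ (\sum_(1 <= r < K.+2) 80 / 3 * M *
  \sum_h history_weight q h * (potential_at r (w_ h) - potential_at r.+1 (w_ h)))).
  rewrite big_nat_cond [leRHS]big_nat_cond; apply: ler_sum => r; rewrite andbT => rK.
  exact: sum_progress_step.
rewrite -mulr_sumr exchange_big/=; rewrite le_eqVlt; apply/orP; left; apply/eqP.
congr (_ * _); apply: eq_bigr => h _; rewrite -mulr_sumr; congr (_ * _).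
by rewrite -[RHS]opprB -(telescope_sumr (fun r => potential_at r (w_ h)))// -sumrN;
  apply: eq_bigr => r _; rewrite opprB.
Qed.

End fixed_horizon.

Let M80 : 0 <= 80 / 3 * M. Proof. by rewrite mulr_ge0// ltW. Qed.

Lemma expected_gap_residual_le (K : nat) (m : T -> nat) : (1 <= K)%N ->
  uniform_index P K m -> independent_index P m i_ ->
  ('E_P[fun w => gap_at (m w) w] <= (80 / 3 * M)%:E *
     ((\int[P]_w (potential_at 1 w - potential_at K.+1 w)%:E) * (K%:R^-1)%:E))%E /\
  ('E_P[fun w => gap_at (m w) w] + 'E_P[fun w => residual_at (m w) w] <=
     (80 / 3 * M)%:E *
     ((\int[P]_w (potential_at 1 w - potential_at K.+1 w)%:E) * (K%:R^-1)%:E))%E.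
Proof.
case: K => // K _ mU mI.
have [w_ w_in] := history_realized q_gt0 i_sampling K.
have cc := history_cellwise_constant w_in.
have E1 : ('E_P[fun w => gap_at (m w) w] = (K.+1%:R^-1 *
    \sum_(1 <= k < K.+2) \sum_h history_weight q h * gap_at k (w_ h))%:E)%E.
  rewrite unlock; apply: (integral_uniform_history q_gt0 i_sampling mU mI) => k kK.
  by have [] := cc k kK.
have E2 : ('E_P[fun w => residual_at (m w) w] = (K.+1%:R^-1 *
    \sum_(1 <= k < K.+2) \sum_h history_weight q h * residual_at k (w_ h))%:E)%E.
  rewrite unlock; apply: (integral_uniform_history q_gt0 i_sampling mU mI) => k kK.
  by have [] := cc k kK.
have E3 : (\int[P]_w (potential_at 1 w - potential_at K.+2 w)%:E =
    (\sum_h history_weight q h * (potential_at 1 (w_ h) - potential_at K.+2 (w_ h)))%:E)%E.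
  apply: (integral_history i_sampling) => h w hw.
  have [_ _ _ c1 _] := cc 1%N (isT : (1 <= 1 <= K.+1)%N).
  have [_ _ _ _ c2] := cc K.+1 (ltac:(by rewrite /= leqnn) : (1 <= K.+1 <= K.+1)%N).
  by rewrite (c1 _ _ hw) (c2 _ _ hw).
rewrite E1 E2 E3 -!EFinM -EFinD !lee_fin.
have k0 : 0 < K.+1%:R^-1 :> R by rewrite invr_gt0.
have main : \sum_(1 <= k < K.+2) \sum_h history_weight q h * gap_at k (w_ h) +
  \sum_(1 <= k < K.+2) \sum_h history_weight q h * residual_at k (w_ h) <=
  80 / 3 * M * \sum_h history_weight q h * (potential_at 1 (w_ h) - potential_at K.+2 (w_ h)).
  apply: le_trans (sum_progress w_in); rewrite -big_split; apply: ler_sum => k _ /=.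
  rewrite -big_split; apply: ler_sum => h _ /=; rewrite -mulrDr.
  by rewrite ler_pM2l ?history_weight_gt0// gap_residual_le_progress.
rewrite -mulrDr [_ * K.+1%:R^-1]mulrC [80 / 3 * M * _]mulrCA !ler_pM2l//; split=> //.
apply: le_trans main; rewrite lerDl; apply: sumr_ge0 => k _; apply: sumr_ge0 => h _.
by rewrite mulr_ge0 ?primal_residual_ge0// ltW// history_weight_gt0.
Qed.

Lemma progress_measurable r : measurable_fun setT (progress_at r.+1).
Proof.
have [w_ w_in] := history_realized q_gt0 i_sampling r.
have [//|_ _ c _ _] := history_cellwise_constant w_in (r := r.+1); first by rewrite /= leqnn.
apply: cellwise_constant_measurable c; last exact: history_event_partition.
by move=> h; exact: (history_event_measurable i_sampling).
Qed.

(** Telescoping bounds the expected partial sums by 80/3 M (Q^1 - low), and monotone convergence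
    exchanges series and integral. *)
Lemma expected_progress_series_lty :
  (\int[P]_w \sum_(0 <= r <oo) (progress_at r.+1 w)%:E < +oo)%E.
Proof.
have [v v_in] := history_realized q_gt0 i_sampling 0.
(* Any sample point would do: the potential at time 1 depends on no picked index. *)
pose w0 := v [ffun=> Ordinal N_gt0].
rewrite integral_nneseries//; last 2 first.
- by move=> r; apply/measurable_realfun.measurable_EFinP; exact: progress_measurable.
- by move=> r w _; rewrite lee_fin progress_ge0.
apply: (@le_lt_trans _ _ (80 / 3 * M * (potential_at 1 w0 - low))%:E); last exact: ltry.
apply: lime_le.
  apply: is_cvg_nneseries => r _ _; apply: integral_ge0 => w _.
  by rewrite lee_fin progress_ge0.
apply: nearW => -[|K].
  rewrite big_geq// lee_fin mulr_ge0// subr_ge0.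
  exact: (potential_ge (run w0) Z1).
have [w_ w_in] := history_realized q_gt0 i_sampling K.
have cc := history_cellwise_constant w_in.
rewrite (eq_big_nat _ _ (F2 := fun r =>
  (\sum_h history_weight q h * progress_at r.+1 (w_ h))%:E)); last first.
  move=> r rK; apply: (integral_history i_sampling).
  by have [] := cc r.+1 rK.
rewrite sumEFin lee_fin.
have := sum_progress w_in; rewrite big_add1/= => /le_trans; apply.
rewrite ler_wpM2l// -[leRHS]mul1r -(@sum_history_weight _ _ q q_sum K) mulr_suml.
apply: ler_sum => h _; rewrite ler_pM2l ?history_weight_gt0//.
apply: lerB; last exact: (potential_ge (run (w_ h)) Z1).
have noidx s : (1 <= s < 1)%N -> i_ s (w_ h) = i_ s w0 by case: s.
have [zE sE] := runs_agree (run (w_ h)) (run w0) noidx (isT : (1 <= 1 <= 1)%N).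
by rewrite /potential_at /potential_real zE sE.
Qed.

(** A nonnegative series with finite expectation is finite almost everywhere, so its terms tend to 0
    there. *)
Lemma ae_progress_cvg0 : {ae P, forall w, progress_at r.+1 w @[r --> \oo] --> 0}.
Proof.
pose f w := (\sum_(0 <= r <oo) (progress_at r.+1 w)%:E)%E.
have f_ge0 w : (0 <= f w)%E.
  by apply: nneseries_ge0 => r _ _; rewrite lee_fin progress_ge0.
have f_int : P.-integrable setT f.
  apply/integrableP; split.
    apply: ge0_emeasurable_sum => [r w _ _|r _]; first by rewrite lee_fin progress_ge0.
    by apply/measurable_realfun.measurable_EFinP; exact: progress_measurable.
  under eq_integral do rewrite gee0_abs//.
  exact: expected_progress_series_lty.
apply: filterS (integrable_ae measurableT f_int) => w /(_ I) fw.
apply: cvg_series_cvg_0.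
apply: nondecreasing_is_cvgn.
  apply: nondecreasing_series => r _ _; exact: progress_ge0.
exists (fine (f w)) => _ [n _ <-].
rewrite -lee_fin fineK// /series/= -sumEFin.
by apply: nneseries_lim_ge => r _ _; rewrite lee_fin progress_ge0.
Qed.

End random_run.

End nestt.

(** * Reduction of the given parameters to M = S^2 and q *)

Theorem theorem2p1 (R : realType) (d N : nat)
  (Z : set 'rV[R]_d) (g : 'I_N -> 'rV[R]_d -> R) (g0 p : 'rV[R]_d -> R)
  (Lg : 'I_N -> R) (L0 Lmean S beta : R) (alpha prob eta : 'I_N -> R)
  (z1 : 'rV[R]_d) (y0 : 'I_N -> 'rV[R]_d)
  (disp : measure_display) (T : measurableType disp) (P : probability T R)
  (i_ : nat -> T -> 'I_N)
  (x : nat -> T -> 'M[R]_(N, d)) (z : nat -> T -> 'rV[R]_d)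
  (lam : nat -> T -> 'M[R]_(N, d))
  (N_gt0 : (0 < N)%N)
  (g_smooth : forall i u, differentiable (g i) u)
  (g0_smooth : forall u, differentiable g0 u)
  (p_convex : convex_function setT p)
  (p_lsc : lower_semicontinuous (EFin \o p))
  (Z_closed : closed Z)
  (Z_convex : convex_set Z)
  (f_bounded : (-oo < ereal_inf [set (objective g g0 p u)%:E | u in Z])%E)
  (g_lip : forall i, lipschitz_grad (g i) (Lg i))
  (g0_lip : lipschitz_grad g0 L0)
  (gmean_lip : lipschitz_grad (gmean g) Lmean)
  (L0_le : L0 <= N%:R^-1 * \sum_(i < N) Lg i)
  (eta_gt0 : forall i, 0 < eta i)
  (eta_gt : forall i, Lg i / N%:R < eta i)
  (eta_sum_gt : ~ convex_function setT g0 -> 3 * L0 < \sum_(i < N) eta i)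
  (alpha_gt0 : forall i, 0 < alpha i)
  (prob_gt0 : forall i, 0 < prob i)
  (prob_sum : \sum_(i < N) prob i = 1)
  (S_def : S = \sum_(j < N) Num.sqrt (Lg j / N%:R))
  (alpha_def : forall i, alpha i = Num.sqrt (Lg i / N%:R) / S)
  (prob_def : forall i, prob i = Num.sqrt (Lg i / N%:R) / S)
  (eta_def : forall i, eta i = 3 * S * Num.sqrt (Lg i / N%:R))
  (beta_def : beta = 1 / (3 * S ^+ 2))
  (z1_in : Z z1)
  (i_sampling : sampling P prob i_)
  (run : forall w, nestt_g Z g g0 p alpha eta z1 y0
           (i_ ^~ w) (x ^~ w) (z ^~ w) (lam ^~ w)) :
  let G (r : nat) (w : T) : R := gap Z g g0 p beta (z r w) in
  let Q (r : nat) (w : T) : \bar R :=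
    potential Z g g0 p alpha eta prob y0 (i_ ^~ w) (z ^~ w) r in
  {ae P, forall w, forall xs zs lams,
     cluster ((fun r => (x r w, z r w, lam r w)) @ \oo) (xs, zs, lams) ->
     stationary Z g g0 p xs zs lams} /\
  (forall (K : nat) (m : T -> nat), (1 <= K)%N ->
     uniform_index P K m -> independent_index P m i_ ->
     ('E_P[fun w => G (m w) w] <=
        (80 / 3 * S ^+ 2)%:E *
        ((\int[P]_w (Q 1%N w - Q K.+1 w)) * (K%:R^-1)%:E))%E /\
     ('E_P[fun w => G (m w) w] +
      'E_P[fun w => (\sum_(i < N) 3 * eta i ^+ 2 *
                      enorm (row i (x (m w).+1 w) - z (m w) w) ^+ 2)%R] <=
        (80 / 3 * S ^+ 2)%:E *
        ((\int[P]_w (Q 1%N w - Q K.+1 w)) * (K%:R^-1)%:E))%E).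
Proof.
have S_ge0 : 0 <= S by rewrite S_def; apply: sumr_ge0 => k _; exact: sqrtr_ge0.
have S_gt0 : 0 < S.
  (* If S were 0, each alpha would be a quotient by 0, that is 0, against its positivity. *)
  rewrite lt_def S_ge0 andbT; apply/eqP => S0.
  by have := alpha_gt0 (Ordinal N_gt0); rewrite alpha_def S0 invr0 mulr0 ltxx.
pose M := S ^+ 2; have M_gt0 : 0 < M by rewrite exprn_gt0.
have sE k : Num.sqrt (Lg k / N%:R) = S * prob k.
  by rewrite prob_def mulrCA divff ?gt_eqF ?mulr1.
have N_neq0 : N%:R != 0 :> R by rewrite pnatr_eq0 -lt0n.
have LgE k : Lg k = N%:R * (M * prob k ^+ 2).
  (* The square root is 0 on nonpositive reals; its positivity gives Lg k / N > 0, which squaring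
     then recovers. *)
  have s_gt0 : 0 < Num.sqrt (Lg k / N%:R) by rewrite sE mulr_gt0.
  have := sqr_sqrtr (ltW (eqbLR (sqrtr_gt0 _) s_gt0)).
  by rewrite sE exprMn => ->; rewrite mulrC divfK.
have alphaE : alpha = prob by apply/funext => k; rewrite alpha_def prob_def.
have etaE : eta = fun k => 3 * M * prob k.
  by apply/funext => k; rewrite eta_def sE /M; ring.
have {beta_def} betaE : beta = (3 * M)^-1 by rewrite beta_def div1r.
have g0_lip' : lipschitz_grad g0 (\sum_(k < N) M * prob k ^+ 2).
  move=> u v; apply: le_trans (g0_lip u v) _; rewrite ler_wpM2r ?enorm_ge0//.
  (* The mean of the [Lg k] is the sum of the M q_k^2. *)
  apply: le_trans L0_le _; rewrite mulr_sumr le_eqVlt; apply/orP; left; apply/eqP.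
  by apply: eq_bigr => k _; rewrite LgE mulKf.
have g_lip' k : lipschitz_grad (g k) (N%:R * (M * prob k ^+ 2)) by rewrite -LgE.
have [low f_low] : exists low, forall u, Z u -> low <= objective g g0 p u.
  have [||b bP] := @ereal_inf_lower_bound R [set objective g g0 p u | u in Z].
  - by exists (objective g g0 p z1), z1.
  - by rewrite image_comp in f_bounded *.
  - by exists b => u Zu; apply: bP; exists u.
have Z_nonempty : Z !=set0 by exists z1.
have p_lsc' := real_lsc_EFin p_lsc.
subst alpha beta eta; move=> G Q.
split.
  have := ae_progress_cvg0 N_gt0 M_gt0 prob_gt0 prob_sum g_smooth g0_smooth p_convex
    p_lsc' Z_closed Z_convex f_low g_lip' g0_lip' Z_nonempty i_sampling run z1_in.
  apply: filterS => w w0 xs zs lams.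
  exact: (cluster_stationary N_gt0 M_gt0 prob_gt0 prob_sum g_smooth g0_smooth p_convex
    p_lsc' Z_closed Z_convex f_low g_lip' g0_lip' Z_nonempty (run w) w0).
move=> K m K1 mU mI.
have QE r w : (1 <= r)%N -> Q r w = (potential_real g g0 p M prob y0 (i_ ^~ w) (z ^~ w) r)%:E.
  by move=> r1; exact: (potentialE M_gt0 prob_gt0 (run w) z1_in r1).
have -> : (\int[P]_w (Q 1%N w - Q K.+1 w) = \int[P]_w
  (potential_real g g0 p M prob y0 (i_ ^~ w) (z ^~ w) 1 -
   potential_real g g0 p M prob y0 (i_ ^~ w) (z ^~ w) K.+1)%:E)%E.
  by apply: eq_integral => w _; rewrite !QE.
have := expected_gap_residual_le N_gt0 M_gt0 prob_gt0 prob_sum g_smooth g0_smooth p_convex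
    p_lsc' Z_closed Z_convex f_low g_lip' g0_lip' Z_nonempty i_sampling run z1_in K1 mU mI.
exact.
Qed.
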